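(* Let $g\geq1$ and let $S_g$ be the genus-$g$ orientable surface group $$S_g=\langle a_1,\dots,a_g,b_1,\dots,b_g\mid [a_1,b_1]\cdots[a_g,b_g]=1\rangle.$$ Let $t\in\{a_1,\dots,a_g,b_1,\dots,b_g\}$ be any generator. If $W$ is a finite set of words in the free group on $\{a_1,\dots,a_g,b_1,\dots,b_g\}$ such that each word in $W$ has $t$-exponent sum at least $0$, then membership in the submonoid of $S_g$ generated by $W$ is decidable.
   Context: $[a,b]=aba^{-1}b^{-1}$. The $t$-exponent sum of a word is the number of occurrences of $t$ minus the number of occurrences of $t^{-1}$. For a group $G$ generated by a finite set $B$ and a finitely generated submonoid $M\leq G$, membership in $M$ is decidable if there is an algorithm that takes any word over $B\cup B^{-1}$ and decides whether the element of $G$ it represents belongs to $M$. *)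

(* Defs.v *)
From HB Require Import structures.
From mathcomp Require Import all_boot all_order all_algebra.
From mathcomp Require Import boolp.

Set Implicit Arguments.
Unset Strict Implicit.
Unset Printing Implicit Defensive.

(* The letter (x, false) is x and the letter (x, true) is x^-1. *)
Definition letter (B : Type) : Type := (B * bool)%type.
Definition word (B : Type) : Type := seq (letter B).

Definition inv_word (B : Type) (w : word B) : word B :=
  rev [seq (l.1, ~~ l.2) | l <- w].

Definition expsum (B : eqType) (t : B) (w : word B) : int :=
  ((count_mem (t, false) w)%:Z - (count_mem (t, true) w)%:Z)%R.

Section WordVal.
Local Open Scope group_scope.
Variables (G : groupType) (B : Type) (b : B -> G).

Definition letter_val (l : letter B) : G := if l.2 then (b l.1)^-1 else b l.1.
Definition word_val (w : word B) : G := \prod_(l <- w) letter_val l.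

Lemma word_val_cat u v : word_val (u ++ v) = word_val u * word_val v.
Proof. by rewrite /word_val big_cat. Qed.

End WordVal.

Section Presentation.
Variables (B : choiceType) (R : seq (word B)).

(* The least congruence on words containing x x^-1 = x^-1 x = 1 for x in B
   and r = 1 for r in R. *)
Inductive pres_eq : word B -> word B -> Prop :=
| PresRefl u : pres_eq u u
| PresSym u v : pres_eq u v -> pres_eq v u
| PresTrans v u w : pres_eq u v -> pres_eq v w -> pres_eq u w
| PresCancel u v x s : pres_eq (u ++ (x, s) :: (x, ~~ s) :: v) (u ++ v)
| PresRel u v r : r \in R -> pres_eq (u ++ r ++ v) (u ++ v).

Lemma pres_eq_catl w u v : pres_eq u v -> pres_eq (w ++ u) (w ++ v).
Proof.
elim=> {u v} [u|u v _|v u z _ IH1 _ IH2|u v x s|u v r rR].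
- exact: PresRefl.
- exact: PresSym.
- exact: PresTrans IH1 IH2.
- by rewrite !catA; exact: PresCancel.
- by rewrite [w ++ (u ++ v)]catA [w ++ (u ++ _)]catA; exact: PresRel.
Qed.

Lemma pres_eq_catr w u v : pres_eq u v -> pres_eq (u ++ w) (v ++ w).
Proof.
elim=> {u v} [u|u v _|v u z _ IH1 _ IH2|u v x s|u v r rR].
- exact: PresRefl.
- exact: PresSym.
- exact: PresTrans IH1 IH2.
- by rewrite -!catA; exact: PresCancel.
- by rewrite -!catA; exact: PresRel.
Qed.

Lemma pres_eq_cat u u' v v' :
  pres_eq u u' -> pres_eq v v' -> pres_eq (u ++ v) (u' ++ v').
Proof.
by move=> h k; apply: PresTrans (pres_eq_catr v h) (pres_eq_catl u' k).
Qed.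

Lemma inv_wordK : involutive (@inv_word B).
Proof.
move=> w; rewrite /inv_word map_rev revK -map_comp -[RHS]map_id.
by apply: eq_map => -[x s] /=; rewrite negbK.
Qed.

Lemma pres_eq_inv_wordr w : pres_eq (w ++ inv_word w) [::].
Proof.
elim: w => [|[x s] w IH]; first exact: PresRefl.
rewrite /inv_word /= rev_cons -cats1 -/(inv_word w).
apply: PresTrans (PresCancel [::] [::] x s).
have := pres_eq_catl [:: (x, s)] (pres_eq_catr [:: (x, ~~ s)] IH).
by rewrite /= catA.
Qed.

Lemma pres_eq_inv_wordl w : pres_eq (inv_word w ++ w) [::].
Proof. by have := pres_eq_inv_wordr (inv_word w); rewrite inv_wordK. Qed.

Lemma pres_eq_inv u v : pres_eq u v -> pres_eq (inv_word u) (inv_word v).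
Proof.
move=> uv.
apply: (@PresTrans ((inv_word u ++ v) ++ inv_word v)).
  rewrite -catA -{1}[inv_word u]cats0; apply: pres_eq_catl.
  exact/PresSym/pres_eq_inv_wordr.
rewrite -[X in pres_eq _ X]cat0s; apply: pres_eq_catr.
apply: PresTrans (pres_eq_inv_wordl u).
exact/pres_eq_catl/PresSym.
Qed.

Definition pres_eqb (u v : word B) : bool := `[< pres_eq u v >].

Lemma pres_eqb_refl : reflexive pres_eqb.
Proof. by move=> u; apply/asboolP; exact: PresRefl. Qed.
Lemma pres_eqb_sym : symmetric pres_eqb.
Proof. by move=> u v; apply/asboolP/asboolP; exact: PresSym. Qed.
Lemma pres_eqb_trans : transitive pres_eqb.
Proof. by move=> v u w /asboolP h /asboolP k; apply/asboolP; exact: PresTrans h k. Qed.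

Definition pres_equiv := EquivRel pres_eqb pres_eqb_refl pres_eqb_sym pres_eqb_trans.
Canonical pres_equiv.

Local Open Scope quotient_scope.

Definition pres_group : Type := {eq_quot pres_equiv}.
HB.instance Definition _ := EqQuotient.on pres_group.
HB.instance Definition _ := Choice.on pres_group.

Definition pres_class (u : word B) : pres_group := \pi_pres_group u.

Lemma pres_classP u v : pres_class u = pres_class v <-> pres_eq u v.
Proof.
by split=> [/eqP|h]; [|apply/eqP]; rewrite eqmodE => /= *; apply/asboolP.
Qed.

Definition pres_one : pres_group := pres_class [::].
Definition pres_mul (x y : pres_group) : pres_group :=
  pres_class (repr x ++ repr y).
Definition pres_inv (x : pres_group) : pres_group :=
  pres_class (inv_word (repr x)).

Lemma pres_reprK x : pres_class (repr x) = x.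
Proof. exact: reprK. Qed.

Lemma pres_eq_repr u : pres_eq (repr (pres_class u)) u.
Proof. by apply/pres_classP; rewrite pres_reprK. Qed.

Lemma pres_mulE u v :
  pres_mul (pres_class u) (pres_class v) = pres_class (u ++ v).
Proof. by apply/pres_classP; apply: pres_eq_cat; exact: pres_eq_repr. Qed.

Lemma pres_invE u : pres_inv (pres_class u) = pres_class (inv_word u).
Proof. by apply/pres_classP; apply: pres_eq_inv; exact: pres_eq_repr. Qed.

Lemma pres_mulA : associative pres_mul.
Proof.
move=> x y z; rewrite -[x]pres_reprK -[y]pres_reprK -[z]pres_reprK.
by rewrite !pres_mulE catA.
Qed.
Lemma pres_mul1 : left_id pres_one pres_mul.
Proof. by move=> x; rewrite -[x]pres_reprK pres_mulE. Qed.
Lemma pres_mulr1 : right_id pres_one pres_mul.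
Proof. by move=> x; rewrite -[x]pres_reprK pres_mulE cats0. Qed.
Lemma pres_mulV : left_inverse pres_one pres_inv pres_mul.
Proof.
move=> x; rewrite -[x]pres_reprK pres_invE pres_mulE.
exact/pres_classP/pres_eq_inv_wordl.
Qed.
Lemma pres_mulrV : right_inverse pres_one pres_inv pres_mul.
Proof.
move=> x; rewrite -[x]pres_reprK pres_invE pres_mulE.
exact/pres_classP/pres_eq_inv_wordr.
Qed.

HB.instance Definition _ := isGroup.Build pres_group
  pres_mulA pres_mul1 pres_mulr1 pres_mulV pres_mulrV.

Definition pres_gen (x : B) : pres_group := pres_class [:: (x, false)].

Lemma word_val_pres w : word_val pres_gen w = pres_class w.
Proof.
elim: w => [|l w IH]; first by rewrite /word_val big_nil.
rewrite -cat1s word_val_cat IH /word_val big_seq1 -[RHS]pres_mulE.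
by congr (_ * _)%g; case: l => x [] //; exact: pres_invE.
Qed.

End Presentation.

(* inl i is a_(i+1) and inr i is b_(i+1). *)
Definition surface_gens (g : nat) : finType := ('I_g + 'I_g)%type.

(* [x, y] = x y x^-1 y^-1, unlike the library's [~ x, y] = x^-1 y^-1 x y. *)
Definition comm_word (B : Type) (x y : B) : word B :=
  [:: (x, false); (y, false); (x, true); (y, true)].

Definition surface_relator (g : nat) : word (surface_gens g) :=
  flatten [seq comm_word (inl i : surface_gens g) (inr i) | i <- enum 'I_g].

Definition surface_group (g : nat) : groupType :=
  pres_group [:: surface_relator g].

Definition surface_gen (g : nat) : surface_gens g -> surface_group g :=
  @pres_gen (surface_gens g) [:: surface_relator g].

Inductive submonoid_gen (G : groupType) (S : seq G) : G -> Prop :=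
| SubmonoidGen x : x \in S -> submonoid_gen S x
| SubmonoidOne : submonoid_gen S 1%g
| SubmonoidMul x y :
    submonoid_gen S x -> submonoid_gen S y -> submonoid_gen S (x * y)%g.

(* Programs for the n-ary partial recursive functions: with classical choice
   every predicate is decided by some Rocq function, so an algorithm has to be
   an object of an explicit model of computation. *)
Inductive murec : nat -> Type :=
| MuZero n : murec n
| MuSucc : murec 1
| MuProj n (i : 'I_n) : murec n
| MuComp n m (f : murec m) (h : 'I_m -> murec n) : murec n
| MuPrec n (f : murec n) (h : murec n.+2) : murec n.+1
| MuMin n (f : murec n.+1) : murec n.

(* [murec_eval c v y]: the program c halts on v with output y.  In primitive
   recursion the recursion variable comes first:
     F(0, v) = f(v)  and  F(k+1, v) = h(k, F(k, v), v);
   minimization returns the least y with f(y, v) = 0, f being defined at all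
   (i, v) with i <= y. *)
Fixpoint murec_eval (n : nat) (c : murec n) : n.-tuple nat -> nat -> Prop :=
  match c in murec n return n.-tuple nat -> nat -> Prop with
  | MuZero _ => fun _ y => y = 0
  | MuSucc => fun v y => y = (thead v).+1
  | MuProj _ i => fun v y => y = tnth v i
  | MuComp _ m f h => fun v y =>
      exists2 w : m.-tuple nat,
        forall i, murec_eval (h i) v (tnth w i) & murec_eval f w y
  | MuPrec n f h => fun v y =>
      let v' : n.-tuple nat := [tuple of behead v] in
      (fix rec (k : nat) (z : nat) : Prop :=
         if k is k'.+1 then
           exists2 z', rec k' z' & murec_eval h [tuple of k' :: z' :: v'] z
         else murec_eval f v' z) (thead v) y
  | MuMin _ f => fun v y =>
      murec_eval f [tuple of y :: v] 0 /\
      forall i, i < y -> exists z, murec_eval f [tuple of i :: v] z.+1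
  end.

Lemma murec_eval_fun n (c : murec n) v y z :
  murec_eval c v y -> murec_eval c v z -> y = z.
Proof.
elim: c v y z => {n} [n|| n i|n m f IHf h IHh|n f IHf h IHh|n f IHf] v y z /=.
- by move=> -> ->.
- by move=> -> ->.
- by move=> -> ->.
- move=> [w hw fw] [w' hw' fw'].
  suff ww' : w = w' by rewrite -ww' in fw'; exact: IHf fw fw'.
  by apply: eq_from_tnth => i; exact: IHh (hw i) (hw' i).
- elim: (thead v) y z => [|k IHk] y z; first exact: IHf.
  by move=> [u ku hu] [u' ku']; rewrite -(IHk _ _ ku ku'); exact: IHh hu.
- move=> [fy ly] [fz lz]; case: (ltngtP y z) => // [/lz|/ly] [u fu].
  + by have := IHf _ _ _ fy fu.
  + by have := IHf _ _ _ fz fu.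
Qed.

(* Words over a finite alphabet with q symbols are coded bijectively by natural
   numbers, written in bijective base q with the first letter least
   significant. *)
Definition word_code (B : finType) (w : word B) : nat :=
  foldr (fun l n => (enum_rank l + #|{: letter B}| * n).+1) 0 w.

Definition membership_decidable (G : groupType) (B : finType) (b : B -> G)
    (M : G -> Prop) : Prop :=
  exists c : murec 1, forall w : word B,
    (M (word_val b w) -> murec_eval c [tuple word_code w] 1) /\
    (~ M (word_val b w) -> murec_eval c [tuple word_code w] 0).

(* Main.v *)
Require Import Defs.
From mathcomp Require Import all_boot all_order all_algebra zify.
From mathcomp Require Import boolp.

(** Let x be the partner of t in its commutator. The relator can be rewritten
    as t x t^-1 = c x, where c is a word in the generators other than t and x.
    Hence the kernel K of the t-exponent sum is a free group: a basis consists
    of x and of all y_h = t^h y t^-h, for h an integer and y a generator other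
    than t and x, while x_h = t^h x t^-h is determined by x_0 = x and
    x_(h+1) = c_h x_h, with c_h the word c in the letters y_h. Reading a word
    letter by letter, from a height h that moves by one with each t or t^-1,
    spells an element of K ([word_at]). This element and the exponent sum depend
    only on the value of the word in the group ([pres_eq_word_at]).

    A word w represents an element of the submonoid M if and only if some product
    w v_1 ... v_n is trivial, where the v_j are inverses of words of W. Their
    exponent sums are at most 0, so along v_1 ... v_n the height at which a new
    factor starts never increases, and it ends at the height where w started.
    Only finitely many positions (unread part of the current word, height) can
    therefore occur, and the products w v_1 ... v_n, read as words over the basis
    of K, are the labels of the paths in a finite graph. Whether one of those
    labels is trivial in the free group K is decided as in Benois' theorem on
    rational subsets: saturate the graph by the pairs of positions joined by a
    path with trivial label. This is the relation [null_run]; [null_run_sound]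
    and [run_null] compare it with the group, and
    [tower_membership_decidable] puts the two together.

    The letter x is in the basis only at height 0. At height h+1 it is replaced
    by t^-1 c x t, the same element of the group, in which x is met at height h;
    in this way every step spells at most one letter of the basis. The reading of
    w starts at a height so large that no height becomes negative:
    positions are pairs of natural numbers.

    It remains to find an algorithm. By Post's theorem it is enough that
    [null_run] and its complement are semidecidable. The first is a least fixed
    point of finitary rules, and a derivation is a finite object
    ([semidec_lfp]). For the second, a finite set of pairs of positions that is
    closed under the rules and does not contain the given pair is a finite
    certificate, because only finitely many positions are reachable
    ([certificate_sound], [certificate_complete], [finitely_many_states]). *)
Import GRing.Theory.

Set Implicit Arguments.
Unset Strict Implicit.
Unset Printing Implicit Defensive.

(** * Computable functions and semidecidable predicates *)

(** Environments are nested pairs, with the newest variable last, because a body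
    [P e x] under a quantifier then becomes a predicate of the environment (e, x)
    by higher-order pattern unification. *)
Fixpoint ctx (n : nat) : Type := if n is n'.+1 then (ctx n' * nat)%type else unit.

(** The newest variable comes first, where recursion and minimization put theirs. *)
Fixpoint coords (n : nat) : ctx n -> n.-tuple nat :=
  match n with
  | 0 => fun _ => [tuple]
  | _.+1 => fun p => [tuple of p.2 :: coords p.1]
  end.

Definition computable n (f : ctx n -> nat) :=
  exists c : murec n, forall e, murec_eval c (coords e) (f e).

(** A substitution of m computable terms with n variables. *)
Fixpoint computable_map n m : (ctx n -> ctx m) -> Prop :=
  match m with
  | 0 => fun _ => True
  | _.+1 => fun s => computable_map (fun e => (s e).1) /\ computable (fun e => (s e).2)
  end.

Lemma computable_ext n (f f' : ctx n -> nat) : f =1 f' -> computable f -> computable f'.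
Proof. by move=> ff' [c cP]; exists c => e; rewrite -ff'. Qed.

Lemma computable_map_programs n m (s : ctx n -> ctx m) : computable_map s ->
  exists h : 'I_m -> murec n, forall e i, murec_eval (h i) (coords e) (tnth (coords (s e)) i).
Proof.
elim: m s => [|m IH] s /=; first by exists (fun=> MuZero n) => e [].
move=> [/IH [h hP] [c cP]].
exists (fun i => if unlift ord0 i is Some j then h j else c) => e i.
case: unliftP => [j|] ->; last by rewrite tnth0.
by rewrite tnthS.
Qed.

Lemma computable_map_comp n m (f : ctx m -> nat) (s : ctx n -> ctx m) :
  computable f -> computable_map s -> computable (fun e => f (s e)).
Proof.
move=> [c cP] /computable_map_programs [h hP]; exists (MuComp c h) => e /=.
by exists (coords (s e)).
Qed.

Lemma computable_var n : computable (fun e : ctx n * nat => e.2 : nat) (n := n.+1).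
Proof. by exists (MuProj ord0) => e /=; rewrite tnth0. Qed.

Lemma computable_map_weak n m (s : ctx n -> ctx m) :
  computable_map s -> computable_map (fun e : ctx n * nat => s e.1) (n := n.+1).
Proof.
elim: m s => //= m IH s [/IH hs [c cP]]; split=> //.
exists (MuComp c (fun i => MuProj (lift ord0 i))) => e /=.
by exists (coords e.1) => // i; rewrite tnthS.
Qed.

Lemma computable_map_id n : computable_map (fun e : ctx n => e).
Proof. by elim: n => //= n IH; split;
  [exact: (computable_map_weak IH) | exact: computable_var]. Qed.

Lemma computable_weak n (f : ctx n -> nat) :
  computable f -> computable (fun e : ctx n * nat => f e.1) (n := n.+1).
Proof. by move=> ft;
  exact: (@computable_map_comp n.+1 n f (fun e : ctx n * nat => e.1) ft
    (computable_map_weak (computable_map_id n))).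
Qed.

Lemma computable_skip n (f : ctx n -> nat -> nat) :
  computable (fun e : ctx n * nat => f e.1 e.2) (n := n.+1) ->
  computable (fun e : ctx n * nat * nat => f e.1.1 e.2) (n := n.+2).
Proof.
move=> ft; apply: (@computable_map_comp n.+2 n.+1 _ (fun e : ctx n.+2 => (e.1.1, e.2)) ft).
by split;
  [exact: (computable_map_weak (computable_map_weak (computable_map_id n)))
  | exact: computable_var].
Qed.

Lemma computable_skip2 n (f : ctx n -> nat -> nat -> nat) :
  computable (fun e : ctx n * nat * nat => f e.1.1 e.1.2 e.2) (n := n.+2) ->
  computable (fun e : ctx n * nat * nat * nat => f e.1.1.1 e.1.2 e.2) (n := n.+3).
Proof.
move=> ft; apply: (@computable_map_comp n.+3 n.+2 _ (fun e : ctx n.+3 => (e.1.1.1, e.1.2, e.2)) ft).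
split; last exact: computable_var.
by split;
  [exact: (computable_map_weak (computable_map_weak (computable_map_weak (computable_map_id n))))
  | exact/computable_weak/computable_var].
Qed.

Lemma computable_subst n (f : ctx n -> nat -> nat) (a : ctx n -> nat) :
  computable (fun e : ctx n * nat => f e.1 e.2) (n := n.+1) -> computable a ->
  computable (fun e => f e (a e)).
Proof.
move=> ft ta;
  apply: (@computable_map_comp n n.+1 (fun e : ctx n * nat => f e.1 e.2) (fun e => (e, a e)) ft).
by split=> //; exact: computable_map_id.
Qed.

(** The recursion is the one in the semantics of primitive recursion: the values
    of a function that satisfies the recursion equations form its graph. *)
Lemma prec_graph (F : nat -> Prop) (H : nat -> nat -> nat -> Prop) (y : nat -> nat) :
  F (y 0) -> (forall k, H k (y k) (y k.+1)) ->
  forall k, (fix rec (k z : nat) : Prop :=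
    if k is k'.+1 then exists2 z', rec k' z' & H k' z' z else F z) k (y k).
Proof. by move=> F0 FS; elim=> // k IH; exists (y k). Qed.

(** The function is given first and its recursion equations are side conditions,
    which spares the comparison with a recursor in every use. *)
Lemma computable_rec n (g : ctx n -> nat -> nat) (f a : ctx n -> nat)
    (h : ctx n -> nat -> nat -> nat) :
  computable f -> computable (fun e : ctx n * nat * nat => h e.1.1 e.2 e.1.2) (n := n.+2) ->
  (forall e, g e 0 = f e) -> (forall e k, g e k.+1 = h e k (g e k)) ->
  computable a -> computable (fun e => g e (a e)).
Proof.
move=> [cf fP] [ch hP] g0 gS; apply: computable_subst; exists (MuPrec cf ch) => -[e k].
rewrite [murec_eval _ _]/= theadE.
apply: (prec_graph (y := g e)) => [|k'] /=.
  by rewrite g0; have := fP e; congr murec_eval; exact: val_inj.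
rewrite gS; have := hP (e, g e k', k').
by congr murec_eval; exact: val_inj.
Qed.

Lemma computable_const n k : computable (fun=> k) (n := n).
Proof.
elim: k => [|k [c cP]]; first by exists (MuZero n).
by exists (MuComp MuSucc (fun=> c)) => e /=; exists [tuple k] => // i; rewrite (ord1 i).
Qed.

Lemma computable_succ n (f : ctx n -> nat) : computable f -> computable (fun e => (f e).+1).
Proof.
move=> [c cP]; exists (MuComp MuSucc (fun=> c)) => e /=.
by exists [tuple f e] => // i; rewrite (ord1 i).
Qed.

Lemma computable_add n (f g : ctx n -> nat) :
  computable f -> computable g -> computable (fun e => f e + g e).
Proof.
move=> tf; apply: (computable_rec (g := fun e k => f e + k) (h := fun _ _ z => z.+1) tf).
- exact/computable_succ/computable_weak/computable_var.
- by move=> e; rewrite addn0.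
- by move=> e k; rewrite addnS.
Qed.

Lemma computable_mul n (f g : ctx n -> nat) :
  computable f -> computable g -> computable (fun e => f e * g e).
Proof.
move=> tf; apply: (computable_rec (g := fun e k => f e * k)
  (h := fun e _ z => f e + z) (computable_const n 0)).
- by apply: computable_add;
  [exact: (computable_weak (computable_weak tf)) | exact/computable_weak/computable_var].
- by move=> e; rewrite muln0.
- by move=> e k; rewrite mulnS.
Qed.

Lemma computable_pred n (f : ctx n -> nat) : computable f -> computable (fun e => (f e).-1).
Proof.
apply: (computable_rec (g := fun _ => predn) (h := fun _ k _ => k) (computable_const n 0)) => //.
exact: computable_var.
Qed.

Lemma computable_sub n (f g : ctx n -> nat) :
  computable f -> computable g -> computable (fun e => f e - g e).
Proof.
move=> tf; apply: (computable_rec (g := fun e k => f e - k) (h := fun _ _ z => z.-1) tf).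
- exact/computable_pred/computable_weak/computable_var.
- by move=> e; rewrite subn0.
- by move=> e k; rewrite subnS.
Qed.

Definition bcomputable n (P : ctx n -> bool) := computable (fun e => P e : nat).

Lemma bcomputable_not n (P : ctx n -> bool) : bcomputable P -> bcomputable (fun e => ~~ P e).
Proof.
by move=> dP; apply: computable_ext (computable_sub (computable_const n 1) dP) => e; case: (P e).
Qed.

Lemma bcomputable_and n (P Q : ctx n -> bool) :
  bcomputable P -> bcomputable Q -> bcomputable (fun e => P e && Q e).
Proof.
by move=> dP dQ; apply: computable_ext (computable_mul dP dQ) => e; case: (P e) (Q e) => -[].
Qed.

Lemma bcomputable_or n (P Q : ctx n -> bool) :
  bcomputable P -> bcomputable Q -> bcomputable (fun e => P e || Q e).
Proof.
move=> dP dQ;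
  apply: computable_ext (bcomputable_not (bcomputable_and (bcomputable_not dP) (bcomputable_not dQ))) => e.
by rewrite negb_and !negbK.
Qed.

Lemma bcomputable_leq n (f g : ctx n -> nat) :
  computable f -> computable g -> bcomputable (fun e => f e <= g e).
Proof.
move=> tf tg;
  apply: computable_ext (computable_sub (computable_const n 1) (computable_sub tf tg)) => e.
by rewrite /leq; case: (f e - g e).
Qed.

Lemma bcomputable_eq n (f g : ctx n -> nat) :
  computable f -> computable g -> bcomputable (fun e => f e == g e).
Proof.
move=> tf tg;
  apply: computable_ext (bcomputable_and (bcomputable_leq tf tg) (bcomputable_leq tg tf)) => e.
by rewrite eqn_leq.
Qed.

Lemma bcomputable_has n (P : ctx n -> nat -> bool) (b : ctx n -> nat) :
  bcomputable (fun e : ctx n * nat => P e.1 e.2) (n := n.+1) -> computable b ->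
  bcomputable (fun e => has (P e) (iota 0 (b e))).
Proof.
move=> dP; apply: (computable_rec (g := fun e k => has (P e) (iota 0 k) : nat)
  (h := fun e k z => 0 < z + P e k) (computable_const n 0)) => //.
  apply: bcomputable_leq; first exact: computable_const.
  apply: computable_add; first exact/computable_weak/computable_var.
  exact: (computable_skip (f := fun e k => P e k : nat)).
move=> e k; rewrite -addn1 iotaD has_cat /= orbF add0n.
by case: has; case: (P e k).
Qed.

Lemma bcomputable_all n (P : ctx n -> nat -> bool) (b : ctx n -> nat) :
  bcomputable (fun e : ctx n * nat => P e.1 e.2) (n := n.+1) -> computable b ->
  bcomputable (fun e => all (P e) (iota 0 (b e))).
Proof.
move=> dP tb;
  apply: computable_ext (bcomputable_not (bcomputable_has (bcomputable_not dP) tb)) => e.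
by rewrite -all_predC; congr nat_of_bool; apply: eq_all => i; exact: negbK.
Qed.

(** The number a stands for the finite set of the positions of the digits 1 in
    its binary expansion; existential quantification over numbers thus gives
    quantification over finite sets. *)
Definition bit (a x : nat) : bool := odd (iter x half a).

Lemma bcomputable_bit n (f g : ctx n -> nat) :
  computable f -> computable g -> bcomputable (fun e => bit (f e) (g e)).
Proof.
have todd m (h : ctx m -> nat) : computable h -> computable (fun e => odd (h e) : nat).
  apply: (computable_rec (g := fun _ k => odd k : nat) (h := fun _ _ z => 1 - z) (computable_const m 0)) => //.
    by apply: computable_sub; [exact: computable_const | exact/computable_weak/computable_var].
  by move=> e k /=; case: odd.
have thalf m (h : ctx m -> nat) : computable h -> computable (fun e => (h e)./2).
  apply: (computable_rec (g := fun _ => half) (h := fun _ k z => odd k + z) (computable_const m 0)) => //.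
    by apply: computable_add; [exact/todd/computable_var | exact/computable_weak/computable_var].
  by move=> e k /=; rewrite uphalf_half.
move=> tf tg; apply: todd; move: tg.
apply: (computable_rec (g := fun e k => iter k half (f e)) (h := fun _ _ z => z./2) tf) => //.
exact/thalf/computable_weak/computable_var.
Qed.

Lemma bit_lt a x : bit a x -> x < a.
Proof.
rewrite /bit; elim: x a => [|x IH] a; first by case: a.
rewrite iterSr => /IH; have := odd_double_half a; lia.
Qed.

Lemma bit_set (p : pred nat) (N : nat) :
  exists a, forall x, bit a x = (x < N) && p x.
Proof.
elim: N p => [|N IH] p.
  by exists 0 => x; rewrite /bit; elim: x => // x IHx; rewrite iterSr.
have [a aP] := IH (fun x => p x.+1); exists (p 0 + a.*2) => -[|x].
  by rewrite /bit /= oddD odd_double addbF; case: (p 0).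
by rewrite /bit iterSr half_bit_double -/(bit a x) aP.
Qed.

(** A pairing function that is a polynomial; it need not be onto. *)
Definition npair (a b : nat) : nat := (a + b) * (a + b) + a.

(** The sum a + b can be read off, since npair a b lies between (a + b)^2 and
    (a + b + 1)^2. *)
Lemma pair_inj a b c d : npair a b = npair c d -> a = c /\ b = d.
Proof.
move=> eqp; suff s : a + b = c + d by move: eqp; rewrite /npair s; lia.
move: eqp; rewrite /npair; case: (ltngtP (a + b) (c + d)) => // lt.
  have := leq_mul lt lt; lia.
have := leq_mul lt lt; lia.
Qed.

Lemma leq_pairl a b : a <= npair a b.
Proof. exact: leq_addl. Qed.
Lemma leq_pairr a b : b <= npair a b.
Proof. rewrite /npair; nia. Qed.

Lemma computable_pair n (f g : ctx n -> nat) :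
  computable f -> computable g -> computable (fun e => npair (f e) (g e)).
Proof. by move=> tf tg; do ?[apply: computable_add|apply: computable_mul]. Qed.

Definition semidec n (P : ctx n -> Prop) :=
  exists2 D : ctx n -> nat -> bool,
    bcomputable (fun e : ctx n * nat => D e.1 e.2) (n := n.+1) &
    forall e, P e <-> exists k, D e k.

Lemma semidec_iff n (P Q : ctx n -> Prop) : (forall e, P e <-> Q e) -> semidec P -> semidec Q.
Proof. by move=> PQ [D dD DP]; exists D => // e; rewrite -PQ. Qed.

Lemma semidec_map m n (P : ctx m -> Prop) (s : ctx n -> ctx m) :
  semidec P -> computable_map s -> semidec (fun e => P (s e)).
Proof.
move=> [D dD DP] ts; exists (fun e k => D (s e) k) => //.
apply: (@computable_map_comp n.+1 m.+1 _ (fun e : ctx n.+1 => (s e.1, e.2)) dD).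
by split; [exact: (computable_map_weak ts) | exact: computable_var].
Qed.

Lemma semidec_dec n (P : ctx n -> bool) : bcomputable P -> semidec P.
Proof.
move=> dP; exists (fun e _ => P e); first exact: (computable_weak dP).
by move=> e; split=> [|[]//]; exists 0.
Qed.

Lemma has_iotaP (p : pred nat) k : reflect (exists2 i, i < k & p i) (has p (iota 0 k)).
Proof.
by apply: (iffP hasP) => -[i]; rewrite ?mem_iota; exists i => //; rewrite mem_iota.
Qed.

(** Two unbounded searches are merged into one by searching for a bound on both
    witnesses. *)
Lemma semidec_ex2 n (P : ctx n -> Prop) (D : ctx n -> nat -> nat -> bool) :
  bcomputable (fun e : ctx n * nat * nat => D e.1.1 e.1.2 e.2) (n := n.+2) ->
  (forall e, P e <-> exists i j, D e i j) -> semidec P.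
Proof.
move=> dD DP.
exists (fun e k => has (fun i => has (D e i) (iota 0 k)) (iota 0 k)).
  apply: (bcomputable_has (n := n.+1) (P := fun e i => has (D e.1 i) (iota 0 e.2)));
    last exact: computable_var.
  apply: (bcomputable_has (n := n.+2) (P := fun e j => D e.1.1 e.2 j));
    last exact/computable_weak/computable_var.
  exact: (computable_skip2 (f := fun e i j => D e i j : nat)).
move=> e; rewrite DP; split=> [[i [j Dij]]|[k /has_iotaP[i _ /has_iotaP[j _ Dij]]]].
  exists (i + j).+1; apply/has_iotaP; exists i; first lia.
  by apply/has_iotaP; exists j => //; lia.
by exists i, j.
Qed.

Lemma semidec_and n (P Q : ctx n -> Prop) : semidec P -> semidec Q -> semidec (fun e => P e /\ Q e).
Proof.
move=> [D dD DP] [D' dD' DP'].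
apply: (semidec_ex2 (D := fun e i j => D e i && D' e j)).
  apply: bcomputable_and; first exact: (computable_weak dD).
  exact: (computable_skip (f := fun e j => D' e j : nat)).
move=> e; rewrite DP DP'; split=> [[[i hi] [j hj]]|[i [j /andP[]]]].
  by exists i, j; rewrite hi.
by split; [exists i | exists j].
Qed.

Lemma semidec_or n (P Q : ctx n -> Prop) : semidec P -> semidec Q -> semidec (fun e => P e \/ Q e).
Proof.
move=> [D dD DP] [D' dD' DP'].
exists (fun e i => D e i || D' e i); first exact: bcomputable_or.
move=> e; rewrite DP DP'; split=> [[] [i hi]|[i /orP[]]].
- by exists i; rewrite hi.
- by exists i; rewrite hi orbT.
- by left; exists i.
- by right; exists i.
Qed.

Lemma semidec_ex n (P : ctx n -> nat -> Prop) :
  semidec (fun e : ctx n * nat => P e.1 e.2) (n := n.+1) -> semidec (fun e => exists x, P e x).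
Proof.
move=> [D dD DP]; apply: (semidec_ex2 (D := fun e i j => D (e, i) j)) => [|e].
  by apply: computable_ext dD => -[[]].
by split=> -[x]; [move/(DP (e, x)) | move/(DP (e, x))]; exists x.
Qed.

(** The finitely many witnesses, one for each x below the bound, are themselves
    bounded by a single number. *)
Lemma semidec_ball n (b : ctx n -> nat) (P : ctx n -> nat -> Prop) :
  computable b -> semidec (fun e : ctx n * nat => P e.1 e.2) (n := n.+1) ->
  semidec (fun e => forall x, x < b e -> P e x).
Proof.
move=> tb [D dD DP].
exists (fun e k => all (fun x => has (D (e, x)) (iota 0 k)) (iota 0 (b e))).
  apply: (bcomputable_all (n := n.+1) (P := fun e x => has (D (e.1, x)) (iota 0 e.2)));
    last exact: (computable_weak tb).
  apply: (bcomputable_has (n := n.+2) (P := fun e j => D (e.1.1, e.2) j));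
    last exact/computable_weak/computable_var.
  by apply: (computable_skip2 (f := fun e x j => D (e, x) j : nat));
    apply: computable_ext dD => -[[]].
move=> e; split=> [Pb|[k /allP Dk] x xb]; last first.
  have /has_iotaP[i _ Di] : has (D (e, x)) (iota 0 k) by apply: Dk; rewrite mem_iota.
  by apply/(DP (e, x)); exists i.
elim: (b e) Pb => [|m IH] Pb; first by exists 0.
have [k /allP kP] := IH (fun x xm => Pb x (leqW xm)).
have [k' k'P] := (DP (e, m)).1 (Pb m (leqnn _)).
exists (k + k').+1; apply/allP => x; rewrite mem_iota add0n ltnS leq0n [x <= m]leq_eqVlt.
case/predU1P => [->|xm]; first by apply/has_iotaP; exists k' => //; lia.
have /has_iotaP[i ik Di] : has (D (e, x)) (iota 0 k) by apply: kP; rewrite mem_iota.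
by apply/has_iotaP; exists i => //; lia.
Qed.

Lemma semidec_imply n (Q : ctx n -> bool) (P : ctx n -> Prop) :
  bcomputable Q -> semidec P -> semidec (fun e => Q e -> P e).
Proof.
move=> dQ rP; apply: semidec_iff (semidec_or (semidec_dec (bcomputable_not dQ)) rP) => e.
by case: (Q e) => /=; split=> [[]|] //; [right; auto|left].
Qed.

Lemma semidec_all_in n (T : eqType) (s : seq T) (P : T -> ctx n -> Prop) :
  (forall x, x \in s -> semidec (P x)) -> semidec (fun e => forall x, x \in s -> P x e).
Proof.
elim: s => [|y s IH] rP.
  by apply: (@semidec_iff n _ _ _ (semidec_dec (P := fun=> true) (computable_const n 1))) => e;
    split.
have rPs : forall x, x \in s -> semidec (P x) by move=> x xs; apply: rP; rewrite inE xs orbT.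
apply: semidec_iff (semidec_and (rP y (mem_head _ _)) (IH rPs)) => e; split.
  by move=> [Py Ps] x; rewrite inE => /predU1P[->|/Ps].
by move=> Ps; split=> [|x xs]; apply: Ps; rewrite inE ?eqxx ?xs ?orbT.
Qed.

Lemma semidec_ex_in n (T : eqType) (s : seq T) (P : T -> ctx n -> Prop) :
  (forall x, x \in s -> semidec (P x)) -> semidec (fun e => exists2 x, x \in s & P x e).
Proof.
elim: s => [|y s IH] rP.
  by apply: (@semidec_iff n _ _ _ (semidec_dec (P := fun=> false) (computable_const n 0))) => e;
    split=> [|[]].
have rPs : forall x, x \in s -> semidec (P x) by move=> x xs; apply: rP; rewrite inE xs orbT.
apply: semidec_iff (semidec_or (rP y (mem_head _ _)) (IH rPs)) => e; split.
  move=> [Py|[x xs Px]]; first by exists y; rewrite ?mem_head.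
  by exists x; rewrite // inE xs orbT.
by move=> [x]; rewrite inE => /predU1P[->|xs] Px; [left|right; exists x].
Qed.

(** Search for a witness of P or of its complement; one exists, and the first one
    found tells which of the two holds. *)
Lemma post_theorem n (P : ctx n -> Prop) : semidec P -> semidec (fun e => ~ P e) ->
  exists c : murec n, forall e,
    (P e -> murec_eval c (coords e) 1) /\ (~ P e -> murec_eval c (coords e) 0).
Proof.
move=> [D [cD cDP] DP] [D' dD' D'P].
have [cN cNP] : bcomputable (fun e : ctx n.+1 => ~~ (D e.1 e.2 || D' e.1 e.2)).
  by apply/bcomputable_not/bcomputable_or => //; exists cD.
have [pr prP] := computable_map_programs (computable_map_id n).
(* The least k with D e k or D' e k, fed back into D. *)
exists (MuComp cD (fun i => if unlift ord0 i is Some j then pr j else MuMin cN)) => e.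
have ex_k : exists k, D e k || D' e k.
  have [/DP [k]|/D'P [k]] := EM (P e); exists k; apply/orP; tauto.
have [k kP kmin] := ex_minnP ex_k.
set c := MuComp _ _; have eval : murec_eval c (coords e) (D e k).
  exists (coords (n := n.+1) (e, k)); last exact: (cDP (e, k)).
  move=> i; case: unliftP => [j|] ->; first by rewrite tnthS; exact: prP.
  rewrite tnth0 /=; split=> [|i' lti].
    by have := cNP (e, k); rewrite /= kP.
  exists 0; have := cNP (e, i').
  case: (boolP (_ || _)) => //= h; have := kmin i' h; lia.
split=> Pe.
  suff Dk : D e k by rewrite Dk in eval.
  case/orP: kP => // Dk'; case: ((D'P e).2 _ Pe); by exists k.
by case: (boolP (D e k)) eval => // Dk; case: Pe; apply/DP; exists k.
Qed.

Section WordCode.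
Variable B : finType.
Implicit Types (u v w : word B) (l : letter B).

(** Putting a fixed word in front of another one is an affine function of the
    codes. So rewriting a prefix of a word needs no decoding. *)
Definition code_cons l (n : nat) : nat := (enum_rank l + #|{: letter B}| * n).+1.
Definition code_cat w (n : nat) : nat := foldr code_cons n w.

Lemma word_code_cat u v : word_code (u ++ v) = code_cat u (word_code v).
Proof. exact: foldr_cat. Qed.

Lemma word_code_inj : injective (@word_code B).
Proof.
elim=> [|l u IH] [|l' u'] //= [] eqc.
have q0 : 0 < #|{: letter B}| by apply/card_gt0P; exists l.
have := congr1 (modn^~ #|{: letter B}|) eqc; have := congr1 (divn^~ #|{: letter B}|) eqc.
rewrite ![_ + _ * _]addnC ![_ * foldr _ _ _]mulnC !divnMDl // !modnMDl.
rewrite !modn_small // !divn_small // !addn0.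
by move=> /IH -> /val_inj/enum_rank_inj ->.
Qed.

(** Every number is the code of a word, hence quantifying over numbers is
    quantifying over words. *)
Lemma word_code_surj (x : B) n : exists u, word_code u = n.
Proof.
have q0 : 0 < #|{: letter B}| by apply/card_gt0P; exists (x, true).
elim/ltn_ind: n => -[|n] IH; first by exists [::].
have [|u uE] := IH (n %/ #|{: letter B}|); first exact: leq_ltn_trans (leq_div _ _) _.
exists (enum_val (Ordinal (ltn_pmod n q0)) :: u) => /=.
by rewrite enum_valK -/(word_code u) uE /= addnC mulnC -divn_eq.
Qed.

Lemma size_word_code u : size u <= word_code u.
Proof.
elim: u => //= l u IH; rewrite ltnS (leq_trans IH) // (leq_trans _ (leq_addl _ _)) // leq_pmull //.
by apply/card_gt0P; exists l.
Qed.

Lemma word_code_bounded s : exists N, forall u, size u <= s -> word_code u <= N.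
Proof.
elim: s => [|s [N NP]]; first by exists 0 => -[].
exists (#|{: letter B}| + #|{: letter B}| * N) => -[|l u] //= /NP uN.
by rewrite -/(word_code u) -addSn leq_add // leq_mul2l uN orbT.
Qed.

Lemma computable_code_cat n w (f : ctx n -> nat) :
  computable f -> computable (fun e => code_cat w (f e)).
Proof.
move=> tf; elim: w => //= l w IH.
by apply/computable_succ/computable_add; [exact: computable_const | apply: computable_mul => //;
  exact: computable_const].
Qed.

Lemma computable_code_cons n l (f : ctx n -> nat) :
  computable f -> computable (fun e => code_cons l (f e)).
Proof. exact: (computable_code_cat [:: l]). Qed.

End WordCode.

(** The equation lets unification find f: after [g (e, a)] is simplified, its
    variables other than a are components of e. *)
Lemma computable_weaken n (f : ctx n -> nat) (g : ctx n.+1 -> nat) :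
  (forall e a, g (e, a) = f e) -> computable f -> computable g.
Proof. by move=> fg tf; apply: computable_ext (computable_weak tf) => -[]. Qed.

Lemma computable_map_weaken n m (f : ctx n -> ctx m) (g : ctx n.+1 -> ctx m) :
  (forall e a, g (e, a) = f e) -> computable_map f -> computable_map g.
Proof. by move=> fg /computable_map_weak tf; rewrite (_ : g = fun e => f e.1) //;
  apply/funext => -[]. Qed.

Ltac solve_computable := cbn beta iota delta [fst snd]; lazymatch goal with
  | |- computable (fun _ => ?k) => exact (computable_const _ k)
  | |- computable (fun e => (@?f e).+1) => apply computable_succ; solve_computable
  | |- computable (fun e => @?f e + @?g e) => apply (@computable_add _ f g); solve_computable
  | |- computable (fun e => npair (@?f e) (@?g e)) => apply (@computable_pair _ f g); solve_computable
  | |- computable (fun e => code_cons ?l (@?f e)) => apply (@computable_code_cons _ _ l f); solve_computable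
  | |- computable (fun e => code_cat ?w (@?f e)) => apply (@computable_code_cat _ _ w f); solve_computable
  | |- computable _ => first [ assumption | apply computable_var
      | eapply computable_weaken; [intros ? ?; cbn [fst snd]; reflexivity | solve_computable] ]
  | |- bcomputable (fun e => ~~ @?P e) => apply (@bcomputable_not _ P); solve_computable
  | |- bcomputable (fun e => @?P e && @?Q e) => apply (@bcomputable_and _ P Q); solve_computable
  | |- bcomputable (fun e => @?f e <= @?g e) => apply (@bcomputable_leq _ f g); solve_computable
  | |- bcomputable (fun e => @eq_op _ (@?f e) (@?g e)) => apply (@bcomputable_eq _ f g); solve_computable
  | |- bcomputable (fun e => bit (@?f e) (@?g e)) => apply (@bcomputable_bit _ f g); solve_computable
  | |- computable_map _ => first [ apply computable_map_id
      | eapply computable_map_weaken; [intros ? ?; cbn [fst snd]; reflexivity | solve_computable]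
      | split; solve_computable ]
  end.

Ltac solve_semidec := cbn beta; lazymatch goal with
  | |- semidec (fun e => exists x : nat, _) => apply semidec_ex; solve_semidec
  | |- semidec (fun e => @ex2 _ (fun x => is_true (@in_mem _ x (@mem _ (seq_predType ?T) ?s))) _) =>
      apply (@semidec_ex_in _ T s); intros ? _; solve_semidec
  | |- semidec (fun e => _ /\ _) => apply semidec_and; solve_semidec
  | |- semidec (fun e => _ \/ _) => apply semidec_or; solve_semidec
  | |- semidec (fun e => forall x : nat, _) => apply semidec_ball; [solve_computable | solve_semidec]
  | |- semidec (fun e => is_true _ -> _) => apply semidec_imply; [solve_computable | solve_semidec]
  | |- semidec (fun e => forall x, is_true (@in_mem _ x (@mem _ (seq_predType ?T) ?s)) -> _) =>
      apply (@semidec_all_in _ T s); intros ? _; solve_semidec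
  | |- semidec (fun e => is_true _) => apply semidec_dec; solve_computable
  | |- _ => idtac
  end.

(** One-premise rules are obtained with b = c. *)
Inductive lfp (A : nat -> Prop) (R : nat -> nat -> nat -> Prop) : nat -> Prop :=
| LfpAx a : A a -> lfp A R a
| LfpRule a b c : R a b c -> lfp A R b -> lfp A R c -> lfp A R a.

(** A derivation is a finite list of numbers in which each one is an axiom or
    follows from two earlier ones. It is coded by the set of all [npair i a] with
    a the i-th number of the list. *)
Lemma semidec_lfp n (A : ctx n -> nat -> Prop) (R : ctx n -> nat -> nat -> nat -> Prop) :
  semidec (fun e : ctx n * nat => A e.1 e.2) (n := n.+1) ->
  semidec (fun e : ctx n * nat * nat * nat => R e.1.1.1 e.1.1.2 e.1.2 e.2) (n := n.+3) ->
  semidec (fun e : ctx n * nat => lfp (A e.1) (R e.1) e.2) (n := n.+1).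
Proof.
move=> rA rR.
pose J (e : ctx n) d i a := A e a \/ exists b, exists c, exists j, exists k,
  bit d (npair j b) && (j < i) /\ bit d (npair k c) && (k < i) /\ R e a b c.
(* The bounds i < d and a < d lose nothing, by [bit_lt]. *)
apply: (@semidec_iff n.+1 (fun e => exists d, exists i, bit d (npair i e.2) /\
  forall i, i < d -> forall a, a < d -> bit d (npair i a) -> J e.1 d i a)).
  move=> [e a] /=; split.
    move=> [d [i [di dP]]]; have {dP} dP i' a' : bit d (npair i' a') -> J e d i' a'.
      move=> h; have hlt := bit_lt h; apply: dP h.
        exact: leq_ltn_trans (leq_pairl _ _) hlt.
      exact: leq_ltn_trans (leq_pairr _ _) hlt.
    elim/ltn_ind: i a di => i IH a di.
    case: (dP i a di) => [/LfpAx //|[b [c [j [k [/andP[dj ji] [/andP[dk ki] Rabc]]]]]]].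
    exact: LfpRule Rabc (IH _ ji _ dj) (IH _ ki _ dk).
  have step s : (forall i, i < size s -> A e (nth 0 s i) \/ exists j k, [/\ j < i, k < i &
      R e (nth 0 s i) (nth 0 s j) (nth 0 s k)]) -> a \in s ->
      exists d, exists i, bit d (npair i a) /\
        forall i, i < d -> forall a, a < d -> bit d (npair i a) -> J e d i a.
    move=> sP sa.
    have [d dP] := bit_set (fun x => has (fun i => x == npair i (nth 0 s i)) (iota 0 (size s)))
      (\max_(i < size s) npair i (nth 0 s i)).+1.
    have bits i : i < size s -> bit d (npair i (nth 0 s i)).
      move=> si; rewrite dP ltnS (leq_bigmax_cond (Ordinal si)) //=.
      by apply/has_iotaP; exists i.
    exists d, (index a s); split.
      by have := bits (index a s); rewrite index_mem nth_index //; apply.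
    move=> i _ a' _; rewrite dP => /andP[_ /has_iotaP[i' si /eqP/pair_inj[-> ->]]].
    case: (sP i' si) => [|[j [k [ji ki Rjk]]]]; first by left.
    right; exists (nth 0 s j), (nth 0 s k), j, k.
    by rewrite !bits ?ji ?ki //; [exact: ltn_trans si|exact: ltn_trans si].
  move=> La; suff [s sP sa] : exists2 s, (forall i, i < size s -> A e (nth 0 s i) \/
      exists j k, [/\ j < i, k < i & R e (nth 0 s i) (nth 0 s j) (nth 0 s k)]) & a \in s.
    exact: step sP sa.
  clear step; elim: La => {}a => [Aa|b c Rabc _ [s sP sb] _ [s' s'P s'c]].
    by exists [:: a]; rewrite ?mem_head // => -[|//]; left.
  exists (s ++ s' ++ [:: a]); last by rewrite !mem_cat mem_seq1 eqxx !orbT.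
  have nthr i : nth 0 (s ++ s' ++ [:: a]) (size s + i) = nth 0 (s' ++ [:: a]) i.
    by rewrite nth_cat ltnNge leq_addr /= addKn.
  move=> i; have [si _|si] := ltnP i (size s).
    case: (sP i si) => [|[j [k [ji ki Rjk]]]]; first by left; rewrite nth_cat si.
    right; exists j, k; split=> //; rewrite !nth_cat si.
    by rewrite !(ltn_trans _ si).
  rewrite -(subnKC si); move: (i - size s) => {si}i; rewrite !size_cat /= ltn_add2l addn1 ltnS.
  rewrite leq_eqVlt => /predU1P[->|si].
    right; exists (index b s), (size s + index c s'); split.
    - by rewrite ltn_addr // index_mem.
    - by rewrite ltn_add2l index_mem.
    - rewrite !nthr !nth_cat !index_mem sb s'c ltnn subnn /= !nth_index //.
  rewrite nthr nth_cat si.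
  case: (s'P i si) => [|[j [k [ji ki Rjk]]]]; first by left.
  right; exists (size s + j), (size s + k); split; rewrite ?ltn_add2l //.
  by rewrite !nthr !nth_cat (ltn_trans ji si) (ltn_trans ki si).
rewrite /J; solve_semidec.
- refine (@semidec_map n.+1 n.+1.+4 _ (fun e : ctx n.+1.+4 => (e.1.1.1.1.1, e.2)) rA _).
  solve_computable.
- refine (@semidec_map n.+3 n.+4.+4.+1 _ (fun e : ctx n.+4.+4.+1 =>
    (e.1.1.1.1.1.1.1.1.1, e.1.1.1.1.2, e.1.1.1.2, e.1.1.2)) rR _).
  solve_computable.
Qed.

(** * A nondeterministic reader of words and its null runs *)

Definition linv (B : Type) (l : letter B) : letter B := (l.1, ~~ l.2).

(** A rule r rewrites the first letter of the unread part: it leads from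
    (popped r :: u, i + before r) to (pushed r ++ u, i + after r), for all u and i.
    Giving both heights relative to i expresses the test that the height is
    positive without a comparison. *)
Notation popped r := (r.1.1.1).
Notation pushed r := (r.1.1.2).
Notation before r := (r.1.2).
Notation after r := (r.2).

Section Machine.
Variables (B : finType) (t : B).
Variables (rules : seq (letter B * word B * nat * nat)) (loads : seq (word B)).
Implicit Types (w : word B) (l : letter B) (h i k : nat).

(** The pairs of positions joined by a path whose label is trivial in the free
    group. Rules and loads have an empty label; a letter other than t read at
    height h has itself, marked with h, as label, and it may cancel only against
    its inverse at the same height. Cancellation is the saturation step. *)
Inductive null_run : word B -> nat -> word B -> nat -> Prop :=
| NullRefl u h : null_run u h u h
| NullRule r u i v k : r \in rules ->
    null_run (pushed r ++ u) (i + after r) v k -> null_run (popped r :: u) (i + before r) v k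
| NullLoad w h v k : w \in loads -> null_run w h v k -> null_run [::] h v k
| NullCancel l u z h v k : l.1 != t ->
    null_run u h (linv l :: z) h -> null_run z h v k -> null_run (l :: u) h v k.

Lemma null_run_trans u h v k z i :
  null_run u h v k -> null_run v k z i -> null_run u h z i.
Proof.
move=> H;
  elim: H => {u h v k} // [r u i' v k rR _ IH|w h v k wL _ IH|l u z' h v k lt H1 _ _ IH] /IH.
- exact: NullRule.
- exact: NullLoad.
- exact: NullCancel.
Qed.

Let letters := [seq l <- enum {: letter B} | l.1 != t].

Lemma mem_letters l : (l \in letters) = (l.1 != t).
Proof. by rewrite mem_filter mem_enum andbT. Qed.

(** The statement that (v, k) can be reached from (u, h), with u and v given by
    their codes. *)
Definition item (u h v k : nat) : nat := npair (npair u h) (npair v k).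

Lemma item_inj u h v k u' h' v' k' :
  item u h v k = item u' h' v' k' -> [/\ u = u', h = h', v = v' & k = k'].
Proof. by move=> /pair_inj[/pair_inj[-> ->] /pair_inj[-> ->]]. Qed.

Lemma leq_pair a b c d : a <= b -> c <= d -> npair a c <= npair b d.
Proof. by move=> ab cd; rewrite /npair leq_add // leq_mul // leq_add. Qed.

Definition null_axiom (x : nat) : Prop := exists u h, x == item u h u h.

(** The code of the empty word is 0. *)
Definition null_rule (x y z : nat) : Prop :=
  (exists2 r, r \in rules & exists u i v k,
     x == item (code_cons (popped r) u) (i + before r) v k /\
     y == item (code_cat (pushed r) u) (i + after r) v k) \/
  (exists2 w, w \in loads & exists h v k,
     x == item 0 h v k /\ y == item (word_code w) h v k) \/
  (exists2 l, l \in letters & exists u a h v k,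
     x == item (code_cons l u) h v k /\
     y == item u h (code_cons (linv l) a) h /\ z == item a h v k).

Lemma null_runE u h v k :
  null_run u h v k <-> lfp null_axiom null_rule (item (word_code u) h (word_code v) k).
Proof.
split.
  elim=> {u h v k} [u h|r u i v k rR _ IH|w h v k wL _ IH|l u z h v k lt _ IH1 _ IH2].
  - by apply: LfpAx; exists (word_code u), h.
  - apply: LfpRule (IH) (IH); left; exists r => //.
    by exists (word_code u), i, (word_code v), k; rewrite word_code_cat !eqxx.
  - apply: LfpRule (IH) (IH); right; left; exists w => //.
    by exists h, (word_code v), k; rewrite !eqxx.
  - apply: LfpRule (IH1) (IH2); right; right; exists l; first by rewrite mem_letters.
    by exists (word_code u), (word_code z), h, (word_code v), k; rewrite !eqxx.
have surj := word_code_surj t; have inj := @word_code_inj B.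
move eqx: (item _ _ _ _) => x L; elim: L u h v k eqx => {x} x.
  by move=> [n [i /eqP ->]] u h v k /item_inj[<- <- /inj -> ->]; exact: NullRefl.
move=> y z [[r rR]|[[w wL]|[l lL]]].
- move=> [n [i [m [j [/eqP -> /eqP ->]]]]] _ IH _ _ u h v k; have [n' n'E] := surj n.
  rewrite -n'E; move=> /item_inj[/(@inj u (_ :: _)) -> -> vE kE].
  by apply: NullRule => //; apply: IH; rewrite word_code_cat n'E vE kE.
- move=> [i [m [j [/eqP -> /eqP ->]]]] _ IH _ _ u h v k.
  move=> /item_inj[/(@inj u [::]) -> -> vE kE].
  by apply: NullLoad wL _; apply: IH; rewrite vE kE.
- move=> [n [a [i [m [j [/eqP -> [/eqP -> /eqP ->]]]]]]] _ IH1 _ IH2 u h v k.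
  have [n' n'E] := surj n; have [a' a'E] := surj a.
  rewrite -n'E; move=> /item_inj[/(@inj u (_ :: _)) -> -> vE kE].
  apply: (NullCancel (z := a')); first by rewrite -mem_letters.
    by apply: IH1; rewrite /= -/(word_code _) -/(word_code a') a'E n'E.
  by apply: IH2; rewrite a'E vE kE.
Qed.

Lemma semidec_null_run C :
  semidec (fun e : ctx 1 => lfp null_axiom null_rule (item e.2 (e.2 + C) 0 (e.2 + C))).
Proof.
have rl : semidec (fun e : ctx 1 * nat => lfp null_axiom null_rule e.2) (n := 2).
  apply: (semidec_lfp (n := 1) (A := fun _ => null_axiom) (R := fun _ => null_rule)).
    by rewrite /null_axiom /item; solve_semidec.
  by rewrite /null_rule /item; solve_semidec.
refine (@semidec_map 2 1 _ (fun e : ctx 1 => (e, item e.2 (e.2 + C) 0 (e.2 + C))) rl _).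
rewrite /item; solve_computable.
Qed.

(** The number b is a set of items closed under the rules of [null_run]. The
    positions p taken into account are those with E p p. They are closed under
    all moves, so that closure of E is required only for finitely many
    positions, and E still contains every null run that starts at the given one. *)
Definition certificate (u0 h0 v0 k0 b : nat) : Prop :=
  let E u h v k := bit b (item u h v k) in
  (E u0 h0 u0 h0 && ~~ E u0 h0 v0 k0) /\
  (forall u, u < b -> forall h, h < b -> forall v, v < b -> forall k, k < b ->
     E u h v k -> E v k v k) /\
  (forall r, r \in rules -> forall u, u < b -> forall i, i < b ->
     E (code_cons (popped r) u) (i + before r) (code_cons (popped r) u) (i + before r) ->
     E (code_cat (pushed r) u) (i + after r) (code_cat (pushed r) u) (i + after r) /\
     forall v, v < b -> forall k, k < b ->
     E (code_cat (pushed r) u) (i + after r) v k -> E (code_cons (popped r) u) (i + before r) v k) /\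
  (forall w, w \in loads -> forall h, h < b ->
     E 0 h 0 h -> E (word_code w) h (word_code w) h /\
     forall v, v < b -> forall k, k < b -> E (word_code w) h v k -> E 0 h v k) /\
  (forall l, l \in letters -> forall u, u < b -> forall h, h < b ->
     E (code_cons l u) h (code_cons l u) h -> E u h u h /\
     forall z, z < b -> E u h (code_cons (linv l) z) h ->
     forall v, v < b -> forall k, k < b -> E z h v k -> E (code_cons l u) h v k).

Lemma semidec_certificate C :
  semidec (fun e : ctx 1 => exists b, certificate e.2 (e.2 + C) 0 (e.2 + C) b).
Proof. rewrite /certificate /item; solve_semidec. Qed.

Lemma leq_code_cons l n : n <= code_cons l n.
Proof.
rewrite /code_cons leqW // (leq_trans _ (leq_addl _ _)) // leq_pmull //.
by apply/card_gt0P; exists l.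
Qed.

(** Induction on the null run, carrying along that its end is again one of the
    positions taken into account. *)
Lemma certificate_sound u h v k b :
  certificate (word_code u) h (word_code v) k b -> ~ null_run u h v k.
Proof.
move=> [/andP[Euh /negP nE] [cR [cRule [cLoad cCancel]]]] H; apply: nE.
have lt u' h' v' k' : bit b (item u' h' v' k') -> [/\ u' < b, h' < b, v' < b & k' < b].
  move=> /bit_lt ltb; split; apply: leq_ltn_trans ltb.
  - exact: leq_trans (leq_pairl _ _) (leq_pairl _ _).
  - exact: leq_trans (leq_pairr _ _) (leq_pairl _ _).
  - exact: leq_trans (leq_pairl _ _) (leq_pairr _ _).
  - exact: leq_trans (leq_pairr _ _) (leq_pairr _ _).
elim: H Euh => {u h v k} // [r u i v k rR _ IH|w h v k wL _ IH|l u z h v k lt' _ IH1 _ IH2] V.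
- have [ub ib _ _] := lt _ _ _ _ V.
  case: (cRule r rR (word_code u) _ i _ V).
  + exact: leq_ltn_trans (leq_code_cons _ _) ub.
  + exact: leq_ltn_trans (leq_addr _ _) ib.
  + rewrite -word_code_cat => /IH E E'; have [_ _ vb kb] := lt _ _ _ _ E.
    exact: E' E.
- have [_ hb _ _] := lt _ _ _ _ V.
  case: (cLoad w wL h hb V) => /IH E E'; have [_ _ vb kb] := lt _ _ _ _ E.
  exact: E' E.
- rewrite -mem_letters in lt'.
  have lL' : linv l \in letters by rewrite mem_letters -[_.1]/(l.1) -mem_letters.
  have [ub hb _ _] := lt _ _ _ _ V.
  have ltu := leq_ltn_trans (leq_code_cons _ _) ub.
  case: (cCancel l lt' (word_code u) ltu h hb V) => Vu Ez.
  have E1 := IH1 Vu; have [_ _ zb _] := lt _ _ _ _ E1.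
  have Vz' := cR _ ltu _ hb _ zb _ hb E1.
  have ltz := leq_ltn_trans (leq_code_cons _ _) zb.
  case: (cCancel _ lL' (word_code z) ltz h hb Vz') => /IH2 E2 _.
  have [_ _ vb kb] := lt _ _ _ _ E2.
  exact: Ez ltz E1 _ vb _ kb E2.
Qed.

(** Closure under all moves, whether or not their labels cancel afterwards. *)
Definition closed_states (V : word B -> nat -> Prop) : Prop :=
  [/\ forall r u i, r \in rules -> V (popped r :: u) (i + before r) -> V (pushed r ++ u) (i + after r),
      forall w h, w \in loads -> V [::] h -> V w h &
      forall l u h, l.1 != t -> V (l :: u) h -> V u h].

Definition bounded_states (V : word B -> nat -> Prop) : Prop :=
  exists N, forall u h, V u h -> word_code u <= N /\ h <= N.

Lemma null_run_closed V u h v k :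
  closed_states V -> null_run u h v k -> V u h -> V v k.
Proof.
move=> [cR cL cC] H;
  elim: H => {u h v k} // [r u i v k rR _ IH|w h v k wL _ IH|l u z h v k lt _ IH1 _ IH2] V0.
- exact/IH/cR.
- exact/IH/cL.
- by apply/IH2/(cC (linv l)) => //; exact/IH1/cC/V0.
Qed.

(** The certificate is the set of all null runs between positions of V. *)
Lemma certificate_complete V u h v k :
  closed_states V -> bounded_states V -> V u h -> ~ null_run u h v k ->
  exists b, certificate (word_code u) h (word_code v) k b.
Proof.
move=> cV [N NP] Vuh nE.
pose P x := `[< exists u h v k,
  [/\ V u h, null_run u h v k & x = item (word_code u) h (word_code v) k] >].
have [b bP] := bit_set P (item N N N N).+1.
have bE u1 h1 v1 k1 :
    bit b (item (word_code u1) h1 (word_code v1) k1) <-> V u1 h1 /\ null_run u1 h1 v1 k1.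
  rewrite bP; split.
    move=> /andP[_ /asboolP[u2 [h2 [v2 [k2 [V2 E2]]]]]].
    by move=> /item_inj[/word_code_inj -> -> /word_code_inj -> ->].
  move=> [V1 E1]; apply/andP; split; last by apply/asboolP; exists u1, h1, v1, k1.
  have [u1N h1N] := NP _ _ V1; have [v1N k1N] := NP _ _ (null_run_closed cV E1 V1).
  by rewrite ltnS !leq_pair.
have bV u1 h1 : bit b (item (word_code u1) h1 (word_code u1) h1) <-> V u1 h1.
  by rewrite bE; split=> [[]|] //; split=> //; exact: NullRefl.
have [cR cL cC] := cV; have surj := word_code_surj t.
exists b; split; [|split; [|split; [|split]]].
- by apply/andP; split; [exact/bV | apply/negP => /bE[]].
- move=> n _ i _ m _ j _; have [[{}n <-] [{}m <-]] := (surj n, surj m).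
  by move=> /bE[/null_run_closed E /E] /(_ cV) /bV.
- move=> r rR n _ i _; have [{}n <-] := surj n.
  rewrite -word_code_cat => /(bV (_ :: n)) Vr.
  split=> [|m _ j _]; first exact/bV/cR.
  have [{}m <-] := surj m; move=> /bE[_ E]; apply/(bE (_ :: n)).
  by split=> //; exact: NullRule.
- move=> w wL i _ /(bV [::]) Vi.
  split=> [|m _ j _]; first exact/bV/cL.
  have [{}m <-] := surj m; move=> /bE[_ E]; apply/(bE [::]).
  by split=> //; exact: NullLoad E.
- move=> l; rewrite mem_letters => lt n _ i _; have [{}n <-] := surj n.
  move=> /(bV (_ :: n)) Vl.
  split=> [|m _]; first exact/bV/cC/Vl.
  have [{}m <-] := surj m; move=> /(bE _ _ (_ :: m))[_ E1].
  move=> p _ j _; have [{}p <-] := surj p; move=> /bE[_ E2].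
  by apply/(bE (_ :: n)); split=> //; exact: NullCancel E1 E2.
Qed.

(** The starting height grows with the word; [word_code w] bounds its length and
    is at hand in the computation. *)
Theorem null_run_decidable C :
  (forall u h, exists V, [/\ closed_states V, bounded_states V & V u h]) ->
  exists c : murec 1, forall w, let h := word_code w + C in
    (null_run w h [::] h -> murec_eval c [tuple word_code w] 1) /\
    (~ null_run w h [::] h -> murec_eval c [tuple word_code w] 0).
Proof.
move=> fin.
have runE w (h := word_code w + C) :
    lfp null_axiom null_rule (item (word_code w) h 0 h) <-> null_run w h [::] h.
  exact: iff_sym (null_runE w h [::] h).
have [|c cP] := post_theorem (semidec_null_run C).
  apply: semidec_iff (semidec_certificate C) => -[e n]; have [w <-] := word_code_surj t n.
  have [V [cV bV Vw]] := fin w (word_code w + C).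
  split=> [[b cb] /runE|/= nE]; first exact: (certificate_sound (v := [::]) cb).
  apply: (certificate_complete (v := [::]) cV bV Vw) => /runE; exact: nE.
exists c => w h; have := cP (tt, word_code w).
have -> : coords (n := 1) (tt, word_code w) = [tuple word_code w] by exact: val_inj.
by case=> yes no; split=> [/runE/yes|nE] //; apply: no => /runE.
Qed.

End Machine.

(** * Reduction in free groups *)

Lemma linvK (B : Type) : involutive (@linv B).
Proof. by case=> y s; rewrite /linv negbK. Qed.

Section FreeReduction.
Variable A : choiceType.
Implicit Types (a : letter A) (s u v : word A).

(** Multiplication of a reduced word by a letter on the left. *)
Definition push a s : word A :=
  if s is a' :: s' then if a' == linv a then s' else a :: s else [:: a].

Definition reduce : word A -> word A := foldr push [::].

Definition reduced : pred (word A) := sorted (fun a b => b != linv a).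

Lemma push_reduced a s : reduced s -> reduced (push a s).
Proof.
case: s => [|b s] //= red; case: (b =P linv a) => [_|/eqP ab] /=.
  exact: path_sorted red.
by rewrite ab red.
Qed.

Lemma reduce_reduced s : reduced (reduce s).
Proof. by elim: s => //= a s; exact: push_reduced. Qed.

(** Reducedness matters when pushing the inverse of a cancels a letter a: the
    next letter is then not the inverse of a, so a is put back. *)
Lemma push_linv a s : reduced s -> push a (push (linv a) s) = s.
Proof.
case: s => [|b s] /=; first by rewrite eqxx.
rewrite linvK; case: (b =P a) => [->|_ _] /=; last by rewrite eqxx.
by case: s => [|b' s] //= /andP[/negPf->].
Qed.

(** Since [push a] and [push (linv a)] are inverse bijections of the reduced
    words, reduction is invariant under the defining relation of the free
    group. *)
Lemma reduce_pres_eq u v : pres_eq [::] u v -> reduce u = reduce v.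
Proof.
elim=> {u v} // [u v w _ -> _ -> //|u v y s].
rewrite /reduce !foldr_cat /=; congr foldr.
exact: (push_linv (y, s) (reduce_reduced v)).
Qed.

End FreeReduction.

(** * Exponent sums *)

Section Words.
Variable B : eqType.
Implicit Types (l : letter B) (u v w : word B).

(** The change of height caused by a letter. *)
Definition shift (t : B) l : int := (if l.1 == t then if l.2 then -1 else 1 else 0)%R.

Lemma expsum_cons t l u : expsum t (l :: u) = (shift t l + expsum t u)%R.
Proof.
rewrite /expsum /shift /=; case: l => y s /=; rewrite !xpair_eqE.
by case: (y == t) s => -[] /=; lia.
Qed.

Lemma expsum_cat t u v : expsum t (u ++ v) = (expsum t u + expsum t v)%R.
Proof. rewrite /expsum !count_cat; lia. Qed.

Lemma expsum_ge t u : (- Posz (size u) <= expsum t u)%R.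
Proof.
rewrite /expsum; have : count_mem (t, true) u <= size u by exact: count_size.
by move: (count_mem (t, true) u) (count_mem (t, false) u) => a b; lia.
Qed.

Lemma expsum_inv t w : expsum t (inv_word w) = (- expsum t w)%R.
Proof.
rewrite /expsum /inv_word !count_rev !count_map.
have E s : count (preim (fun l => (l.1, ~~ l.2)) (pred1 (t, s))) w = count_mem (t, ~~ s) w.
  by apply: eq_count => -[y s'] /=; rewrite !xpair_eqE; case: (y == t) s s' => -[] [].
rewrite !E /=; lia.
Qed.

Lemma mem_inv_word l w : (l \in inv_word w) = (linv l \in w).
Proof.
rewrite mem_rev; apply/mapP/idP => [[l' lw ->]|lw].
  by rewrite -[(_, _)]/(linv l') linvK.
by exists (linv l); rewrite // -[RHS]/(linv (linv l)) linvK.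
Qed.

End Words.

Lemma size_inv_word (B : Type) (w : word B) : size (inv_word w) = size w.
Proof. by rewrite size_rev size_map. Qed.

(** * The free kernel of the exponent sum *)

Definition avoids (B : eqType) (y z : B) (u : word B) : Prop :=
  forall l, l \in u -> (l.1 != y) && (l.1 != z).

Lemma avoids_inv (B : eqType) (y z : B) u : avoids y z u -> avoids y z (inv_word u).
Proof. by move=> au l; rewrite mem_inv_word => /au. Qed.

Lemma avoids_cons (B : eqType) (y z : B) l u :
  avoids y z (l :: u) -> [/\ l.1 != y, l.1 != z & avoids y z u].
Proof.
move=> au; have /andP[ly lz] := au l (mem_head _ _).
by split=> // l' l'u; apply: au; rewrite inE l'u orbT.
Qed.

Section Tower.

Variables (B : finType) (t x : B) (c : word B).

(** The letter (y, h) stands for t^h y t^-h. *)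
Local Notation A := (B * int)%type.
Local Notation F := (pres_group ([::] : seq (word A))).
Local Notation cl := (pres_class ([::] : seq (word A))).

Lemma cl_cat u v : cl (u ++ v) = (cl u * cl v)%g.
Proof. by rewrite -!word_val_pres word_val_cat. Qed.

Lemma cl1 y : cl [:: (y, true)] = ((cl [:: (y, false)])^-1)%g.
Proof. by symmetry; exact: (pres_invE [::] [:: (y, false)]). Qed.

Definition at_level (h : int) (w : word B) : word A := [seq ((l.1, h), l.2) | l <- w].

Lemma cl_level_inv h w : cl (at_level h (inv_word w)) = ((cl (at_level h w))^-1)%g.
Proof.
have -> : at_level h (inv_word w) = inv_word (at_level h w).
  by rewrite /at_level /inv_word map_rev -!map_comp.
by symmetry; exact: pres_invE.
Qed.

(** The solution of x_(h+1) = c_h x_h with x_0 a basis element, going up and down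
    from height 0. *)
Fixpoint xpos (n : nat) : F :=
  (if n is n'.+1 then cl (at_level n' c) * xpos n' else cl [:: ((x, 0%R), false)])%g.

Fixpoint xneg (n : nat) : F :=
  ((cl (at_level (Negz n) c))^-1 * (if n is n'.+1 then xneg n' else xpos 0))%g.

Definition xval (h : int) : F := match h with Posz n => xpos n | Negz n => xneg n end.

Lemma xvalS h : xval (h + 1) = (cl (at_level h c) * xval h)%g.
Proof.
case: h => n; first by rewrite -PoszD addn1.
case: n => [|n]; first by rewrite /= mulVKg.
have -> : (Negz n.+1 + 1)%R = Negz n by lia.
by rewrite /= mulVKg.
Qed.

Definition gen_at (h : int) (y : B) : F :=
  if y == x then xval h else cl [:: ((y, h), false)].

(** The letters t^1 and t^-1 only move the height. *)
Definition letter_at (h : int) (l : letter B) : F :=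
  if l.1 == t then 1%g else letter_val (gen_at h) l.

Fixpoint word_at (h : int) (w : word B) : F :=
  if w is l :: w' then (letter_at h l * word_at (h + shift t l) w')%g else 1%g.

Lemma word_at_cat h u v : word_at h (u ++ v) = (word_at h u * word_at (h + expsum t u) v)%g.
Proof.
elim: u h => [|l u IH] h; first by rewrite mul1g /expsum /= subrr addr0.
by rewrite /= IH -mulgA expsum_cons (addrA h (shift t l)).
Qed.

Lemma shift_linv l : (shift t l + shift t (linv l) = 0)%R.
Proof. by rewrite /shift; case: l => y [] /=; case: (y == t) => /=; lia. Qed.

Lemma word_at_cancel h l u : word_at h (l :: linv l :: u) = word_at h u.
Proof.
rewrite /= -addrA shift_linv addr0 mulgA; rewrite -[RHS]mul1g; congr (_ * _)%g.
rewrite /letter_at /shift /=; case: (l.1 == t); first by rewrite mulg1.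
by rewrite addr0 /letter_val; case: l => y [] /=; rewrite ?mulgV ?mulVg.
Qed.

Lemma word_at_level h u : avoids t x u ->
  word_at h u = cl (at_level h u).
Proof.
elim: u => //= l u IH /avoids_cons[lt lx ut].
rewrite /shift (negPf lt) addr0 (IH ut).
rewrite -[_ :: _](cat1s ((l.1, h), l.2)) cl_cat; congr (_ * _)%g.
by rewrite /letter_at (negPf lt) /letter_val /gen_at (negPf lx); case: l.2; rewrite ?cl1.
Qed.

Lemma expsum_avoids u : avoids t x u -> expsum t u = 0%R.
Proof.
elim: u => //= l u IH /avoids_cons[lt lx ut].
by rewrite expsum_cons /shift (negPf lt) add0r IH.
Qed.

Section Invariance.
Variable R : seq (word B).
Hypothesis R_trivial : forall r, r \in R -> expsum t r = 0%R /\ forall h, word_at h r = 1%g.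

(** The map sending a word to the pair of [word_at] and [expsum] is a homomorphism
    to the semidirect product of the free kernel by the integers; it is enough
    that the relators are killed at every height. *)
Lemma pres_eq_word_at u v : pres_eq R u v ->
  expsum t u = expsum t v /\ forall h, word_at h u = word_at h v.
Proof.
elim=> {u v} [u|u v _ [E V]|u v w _ [E V] _ [E' V']|u v y s|u v r /R_trivial[E V]] //.
- by split=> [|h]; rewrite ?V.
- by split=> [|h]; rewrite ?E ?V.
- split=> [|h]; last by rewrite !word_at_cat (word_at_cancel _ (y, s)).
  by rewrite !expsum_cat !expsum_cons (addrA (shift t (y, s))) (shift_linv (y, s)) add0r.
- by split=> [|h]; rewrite ?expsum_cat ?E ?add0r // !word_at_cat V E addr0 mul1g.
Qed.

End Invariance.

(** * The reader for t x t^-1 = c x *)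

Hypothesis tx : x != t.
Hypothesis c_avoids : avoids t x c.

(** The first two rules read t and t^-1, the last two express x and x^-1 one level
    lower by the relation t x t^-1 = c x. *)
Definition tower_rules : seq (letter B * word B * nat * nat) :=
  [:: ((t, false), [::], 0, 1);
      ((t, true), [::], 1, 0);
      ((x, false), (t, true) :: c ++ [:: (x, false); (t, false)], 1, 1);
      ((x, true), [:: (t, true), (x, true) & inv_word c ++ [:: (t, false)]], 1, 1)].

Section Machine.
Variable loads : seq (word B).

(** Paths with their labels: the third argument is the word over the free basis
    spelled along the way. At a positive height x may also be read under the
    label (x, h), outside the basis; the runs constructed below never do so. *)
Inductive run : word B -> nat -> word A -> word B -> nat -> Prop :=
| RunRefl u h : run u h [::] u h
| RunRule r u i s v k : r \in tower_rules ->
    run (pushed r ++ u) (i + after r) s v k -> run (popped r :: u) (i + before r) s v k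
| RunLoad w h s v k : w \in loads -> run w h s v k -> run [::] h s v k
| RunRead l u h s v k : l.1 != t -> run u h s v k ->
    run (l :: u) h (((l.1, Posz h), l.2) :: s) v k.

Lemma run_trans u h s v k s' z i : run u h s v k -> run v k s' z i -> run u h (s ++ s') z i.
Proof.
move=> H;
  elim: H => {u h s v k} // [r u i' s v k rR _ IH|w h s v k wL _ IH|l u h s v k lt _ IH] /IH.
- exact: RunRule.
- exact: RunLoad.
- exact: RunRead.
Qed.

Local Notation null := (null_run t tower_rules loads).

(** The word s can be read from (u, h) to (v, k) if null runs may be inserted
    between its letters. *)
Fixpoint reads (s : word A) (u : word B) (h : nat) (v : word B) (k : nat) : Prop :=
  if s is a :: s' then
    exists l u' h', [/\ null u h (l :: u') h', l.1 != t, a = ((l.1, Posz h'), l.2) & reads s' u' h' v k]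
  else null u h v k.

Lemma null_reads s u h u' h' v k : null u h u' h' -> reads s u' h' v k -> reads s u h v k.
Proof.
case: s => [|a s] /= uu'; first exact: null_run_trans.
move=> [l [z [i [u'l lt aE sP]]]]; exists l, z, i; split=> //.
exact: null_run_trans u'l.
Qed.

(** Benois: if a label can be read then so can its reduced form, because the
    cancellation of two letters around a null run gives a null run. *)
Lemma run_reads u h s v k : run u h s v k -> reads (reduce s) u h v k.
Proof.
elim=> {u h s v k} [u h|r u i s v k rR _|w h s v k wL _|l u h s v k lt _] /=.
- exact: NullRefl.
- by apply: null_reads; apply: NullRule => //; exact: NullRefl.
- by apply: null_reads; apply: NullLoad wL _; exact: NullRefl.
case: (reduce s) => [|a s'] /= IH.
  by exists l, u, h; split=> //; exact: NullRefl.
case: eqP => [aE|_]; last by exists l, u, h; split=> //; exact: NullRefl.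
move: IH => [l' [z [i [uz l't]]]]; rewrite aE => -[l1 hi l2] zv.
move: uz zv; rewrite -hi (_ : l' = linv l) => [uz zv|]; last first.
  by rewrite /linv l1 l2 -surjective_pairing.
by apply: null_reads zv; apply: NullCancel uz _; last exact: NullRefl.
Qed.

Lemma run_null u h s v k : run u h s v k -> cl s = 1%g -> null u h v k.
Proof.
move=> /run_reads us /(@pres_classP _ [::] s [::])/reduce_pres_eq s1.
by rewrite s1 in us.
Qed.

Lemma run_t u h s v k : run u h.+1 s v k -> run ((t, false) :: u) h s v k.
Proof.
move=> H; rewrite -[h]addn0.
by apply: (RunRule (r := ((t, false), [::], 0, 1))); rewrite ?inE ?eqxx //= addn1.
Qed.

Lemma run_tV u h s v k : run u h s v k -> run ((t, true) :: u) h.+1 s v k.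
Proof.
move=> H; rewrite -[h.+1]addn1.
by apply: (RunRule (r := ((t, true), [::], 1, 0))); rewrite ?inE ?eqxx ?orbT //= addn0.
Qed.

Lemma run_avoids u z h : avoids t x u ->
  run (u ++ z) h (at_level h u) z h.
Proof.
elim: u => [_|l u IH /avoids_cons[lt _ ut]]; first exact: RunRefl.
exact: RunRead lt (IH ut).
Qed.

(** Above height 0 the letter x is expressed one level lower, where the induction
    hypothesis reads it; the prefix c contributes the factor c_h in
    x_(h+1) = c_h x_h. *)
Lemma run_x z h b : exists2 s, run ((x, b) :: z) h s z h &
  cl s = letter_val xval (Posz h, b).
Proof.
elim: h z => [|h IH] z.
  exists [:: ((x, 0%R), b)]; first by apply: (RunRead (l := (x, b))) => //; exact: RunRefl.
  by case: b; rewrite ?cl1.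
have hS : Posz h.+1 = (Posz h + 1)%R by lia.
have cV := avoids_inv c_avoids.
have [s sP sE] := IH (if b then inv_word c ++ (t, false) :: z else (t, false) :: z).
case: b {IH} sP sE => sP sE.
  exists (s ++ at_level h (inv_word c)).
    rewrite -[h.+1]addn1;
      apply: (RunRule (r := ((x, true), [:: (t, true), (x, true) & inv_word c ++ [:: (t, false)]], 1, 1))).
      by rewrite !inE eqxx !orbT.
    rewrite /= addn1 -catA; apply/run_tV/(run_trans sP); rewrite -[at_level _ _]cats0.
    by apply: run_trans (run_avoids _ _ cV) _; apply: run_t; exact: RunRefl.
  by rewrite cl_cat sE /letter_val /= cl_level_inv -invgM -[xpos h]/(xval h) -xvalS -hS.
exists (at_level h c ++ s).
  rewrite -[h.+1]addn1;
    apply: (RunRule (r := ((x, false), (t, true) :: c ++ [:: (x, false); (t, false)], 1, 1))).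
    by rewrite !inE eqxx !orbT.
  rewrite /= addn1 -catA; apply: run_tV; apply: run_trans (run_avoids _ _ c_avoids) _.
  rewrite -[s]cats0; apply: run_trans sP _; apply: run_t; exact: RunRefl.
by rewrite cl_cat sE.
Qed.

(** The reader spells [word_at], provided that the height cannot become
    negative. *)
Lemma run_word u z h : size u <= h ->
  exists s k, [/\ run (u ++ z) h s z k, Posz k = (Posz h + expsum t u)%R & cl s = word_at h u].
Proof.
elim: u h => [|[y b] u IH] h /= uh.
  by exists [::], h; split; [exact: RunRefl | rewrite /expsum subrr addr0 |].
have [yt|yt] := eqVneq y t.
  rewrite yt; case: b => /=.
    case: h uh => [//|h] uh; have [s [k [us kE sE]]] := IH h uh.
    exists s, k; split; first exact: run_tV.
      by rewrite expsum_cons /shift /= eqxx kE; lia.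
    rewrite sE /letter_at /shift /= eqxx mul1g; congr word_at; lia.
  have [s [k [us kE sE]]] := IH h.+1 (leqW (ltnW uh)).
  exists s, k; split; first exact: run_t.
    by rewrite expsum_cons /shift /= eqxx kE; lia.
  rewrite sE /letter_at /shift /= eqxx mul1g; congr word_at; lia.
have [s [k [us kE sE]]] := IH h (ltnW uh).
rewrite expsum_cons /letter_at /shift /= (negPf yt) add0r addr0.
have [yx|yx] := eqVneq y x.
  rewrite yx; have [s' us' s'E] := run_x (u ++ z) h b.
  exists (s' ++ s), k; split=> //; first exact: run_trans us' us.
  by rewrite cl_cat sE s'E /letter_val /gen_at /= eqxx.
exists (((y, Posz h), b) :: s), k; split=> //; first exact: (RunRead (l := (y, b))).
rewrite -[_ :: _](cat1s ((y, Posz h), b)) cl_cat sE; congr (_ * _)%g.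
by rewrite /letter_val /gen_at /= (negPf yx); case: (b); rewrite ?cl1.
Qed.

(** An upper bound for the length of the unread part at all later times before
    the next load. An x at height h is expressed h times, each time adding the
    length of c and two letters t. *)
Fixpoint cost (h : nat) (u : word B) : nat :=
  if u is l :: u' then
    if l.1 == t then (cost (if l.2 then h.-1 else h.+1) u').+1
    else ((if l.1 == x then h * (size c).+2 else 0) + cost h u').+1
  else 0.

Lemma size_cost h u : size u <= cost h u.
Proof.
elim: u h => //= l u IH h; case: (l.1 == t); rewrite ltnS //.
exact: leq_trans (IH h) (leq_addl _ _).
Qed.

Lemma cost_avoids h u z : avoids t x u ->
  cost h (u ++ z) = size u + cost h z.
Proof.
elim: u => //= l u IH /avoids_cons[/negPf-> /negPf-> ut].
by rewrite add0n IH.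
Qed.

Lemma tower_rules_shift r u : r \in tower_rules ->
  (Posz (after r) + expsum t (pushed r ++ u) = Posz (before r) + expsum t (popped r :: u))%R.
Proof.
have eV : expsum t (inv_word c) = 0%R by rewrite expsum_inv expsum_avoids // oppr0.
rewrite !inE => /or4P[]/eqP-> /=;
  rewrite ?(expsum_cat, expsum_cons) /shift /= ?eqxx ?(negPf tx) ?eV ?(expsum_avoids c_avoids);
  rewrite /expsum /=; lia.
Qed.

Lemma tower_rules_cost r u i : r \in tower_rules ->
  cost (i + after r) (pushed r ++ u) <= cost (i + before r) (popped r :: u).
Proof.
have cV := avoids_inv c_avoids.
rewrite !inE => /or4P[]/eqP-> /=; rewrite ?eqxx ?(negPf tx) ?addn1 ?addn0 //=.
- by rewrite -catA (cost_avoids _ _ c_avoids) /= ?eqxx ?(negPf tx) mulSn;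
  move: (size c) (cost _ u) => a b; lia.
- by rewrite -catA (cost_avoids _ _ cV) /= size_inv_word ?eqxx ?(negPf tx) mulSn;
  move: (size c) (cost _ u) => a b; lia.
Qed.

Hypothesis loads_le0 : forall w, w \in loads -> (expsum t w <= 0)%R.

(** The final height of the current word, which is the sum of the height and of
    the exponent sum of the unread part, is kept by the rules and by reading a
    letter, and never increases at a load. Therefore loads take place at finitely many heights, and
    the cost of the loaded words is bounded. *)
Lemma finitely_many_states u0 h0 : exists V,
  [/\ closed_states t tower_rules loads V, bounded_states V & V u0 h0].
Proof.
pose N : int := (Posz h0 + expsum t u0)%R.
(* Loads occur at heights at most N. *)
pose K := maxn (cost h0 u0) (\max_(h < `|N|%N.+1) \max_(w <- loads) cost h w).
exists (fun u h => cost h u <= K /\ (Posz h + expsum t u <= N)%R); split; last by rewrite leq_maxl.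
  split=> [r u i rR [uK uN]|w h wL [_ hN]|l u h lt [/= uK uN]].
  - split; first exact: leq_trans (tower_rules_cost _ _ rR) uK.
    have := tower_rules_shift u rR; lia.
  - rewrite /expsum /= subrr addr0 in hN.
    split; last by have := loads_le0 wL; lia.
    have hN' : h < `|N|%N.+1 by lia.
    rewrite leq_max; apply/orP; right.
    apply: leq_trans (leq_bigmax (Ordinal hN')).
    by rewrite (leq_bigmax_seq (F := cost h)).
  - rewrite (negPf lt) in uK; rewrite expsum_cons /shift (negPf lt) add0r in uN.
    split=> //; apply: leq_trans uK; exact: leqW (leq_addl _ _).
have [M MP] := word_code_bounded B K.
exists (M + (`|N|%N + K)) => u h [uK uN]; have su := leq_trans (size_cost h u) uK.
split; first exact: leq_trans (MP u su) (leq_addr _ _).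
have := expsum_ge t u; move: (expsum t u) (size u) su uN => a b; lia.
Qed.

End Machine.

Section Membership.
Variables (R : seq (word B)) (W : seq (word B)).
Hypothesis R_trivial : forall r, r \in R -> expsum t r = 0%R /\ forall h, word_at h r = 1%g.
Hypothesis R_conj : pres_eq R [:: (t, false); (x, false); (t, true)] (c ++ [:: (x, false)]).
Hypothesis W_ge0 : forall w, w \in W -> (0 <= expsum t w)%R.

Local Notation gen := (@pres_gen B R).
Local Notation ev := (word_val gen).
Local Notation M := (submonoid_gen (map ev W)).
Let loads := map (@inv_word B) W.
Let T : pres_group R := gen t.
Local Open Scope group_scope.

Lemma ev_cons l u : ev (l :: u) = letter_val gen l * ev u.
Proof. by rewrite /word_val big_cons. Qed.

Lemma ev_inv u : ev (inv_word u) = (ev u)^-1.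
Proof. by rewrite !word_val_pres; symmetry; exact: pres_invE. Qed.

Lemma ev_linv l : letter_val gen (linv l) = (letter_val gen l)^-1.
Proof. by case: l => y []; rewrite /letter_val //= invgK. Qed.

(** Conjugation by t, the consequence of the relators on which the soundness of
    the last two rules rests. *)
Lemma gen_conj : T * gen x = ev c * gen x * T.
Proof.
have /pres_classP := R_conj; rewrite -!word_val_pres word_val_cat !ev_cons.
rewrite /word_val big_nil !mulg1 /letter_val /= mulgA => E.
by rewrite -E mulgVK.
Qed.

Lemma tower_rules_sound r u i : r \in tower_rules ->
  T ^+ (i + before r) * ev (popped r :: u) = T ^+ (i + after r) * ev (pushed r ++ u).
Proof.
rewrite !inE => /or4P[]/eqP-> /=.
- by rewrite addn0 addn1 ev_cons mulgA /letter_val /= -expgSr.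
- by rewrite addn0 addn1 ev_cons mulgA /letter_val /= expgSr mulgK.
- rewrite !ev_cons -catA word_val_cat !ev_cons /letter_val /= -/T; congr (_ * _).
  by rewrite !mulgA; congr (_ * _); rewrite -!mulgA (mulgA (ev c)) -gen_conj mulKg.
- rewrite !ev_cons -catA word_val_cat !ev_cons ev_inv /letter_val /= -/T; congr (_ * _).
  rewrite !mulgA; congr (_ * _); apply: (mulIg T^-1); rewrite mulgK -!invgM.
  by rewrite gen_conj mulgA.
Qed.

(** Reading u from height h up to (v, k) along a null run amounts to an equality
    in the group. In the case of a cancellation, l and its inverse are met at the
    same height, so the conjugating powers of t agree. *)
Lemma null_run_sound u h v k : null_run t tower_rules loads u h v k ->
  exists2 m, M m & T ^+ h * ev u = T ^+ k * ev v * m.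
Proof.
elim=> {u h v k} [u h|r u i v k rR _ [m Mm E]|w h v k /mapP[w' w'W ->] _ [m Mm E]
  |l u z h v k lt _ [m Mm E] _ [m' Mm' E']].
- by exists 1; [exact: SubmonoidOne | rewrite mulg1].
- by exists m; rewrite // tower_rules_sound.
- exists (m * ev w'); first by apply: SubmonoidMul => //; apply/SubmonoidGen/map_f.
  by rewrite mulgA -E ev_inv mulgVK /word_val big_nil mulg1.
- exists (m' * m); first exact: SubmonoidMul.
  rewrite mulgA -E' -mulgA; congr (_ * _); rewrite ev_cons.
  move: E; rewrite -mulgA => /mulgI ->; rewrite ev_cons ev_linv -!mulgA mulVKg //.
Qed.

(** The loaded words are the inverses of the words of W, in reverse order. *)
Lemma submonoid_inverse_loads m : M m ->
  exists2 ws : seq (word B), {subset ws <= loads} & m * ev (flatten ws) = 1.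
Proof.
elim=> {m} [m /mapP[w wW ->]||m m' _ [ws wsL E] _ [ws' wsL' E']].
- exists [:: inv_word w]; first by move=> w'; rewrite inE => /eqP->; exact: map_f.
  by rewrite /= cats0 ev_inv mulgV.
- by exists [::] => //; rewrite mul1g /word_val big_nil.
- exists (ws' ++ ws); first by move=> w; rewrite mem_cat => /orP[/wsL'|/wsL].
  by rewrite flatten_cat word_val_cat mulgA -(mulgA m) E' mulg1.
Qed.

Lemma loads_le0 w : w \in loads -> (expsum t w <= 0)%R.
Proof. by move=> /mapP[w' /W_ge0 w'0 ->]; rewrite expsum_inv; lia. Qed.

(** The height never increases from one load to the next, so the final height
    bounds from below the height at the start of each word. *)
Lemma run_loads C ws h :
  {subset ws <= loads} -> (forall w, w \in loads -> size w <= C) ->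
  (Posz C <= Posz h + expsum t (flatten ws))%R ->
  exists s k, [/\ run loads [::] h s [::] k, Posz k = (Posz h + expsum t (flatten ws))%R
    & pres_class [::] s = word_at h (flatten ws)].
Proof.
elim: ws h => [|w ws IH] h wsL CP.
  by exists [::], h; split; [exact: RunRefl | rewrite /expsum subrr addr0 |].
have wL : w \in loads by apply: wsL; rewrite mem_head.
have wsL' : {subset ws <= loads} by move=> w' w'ws; apply: wsL; rewrite inE w'ws orbT.
have ws_le0 : (expsum t (flatten ws) <= 0)%R.
  elim: (ws) wsL' => //= w' ws' IHw ws'L; rewrite expsum_cat.
  have /loads_le0 := ws'L w' (mem_head _ _).
  have : (expsum t (flatten ws') <= 0)%R.
    by apply: IHw => w'' w''ws; apply: ws'L; rewrite inE w''ws orbT.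
  lia.
rewrite /= expsum_cat => hC; have w_le0 := loads_le0 wL; have wC := CP w wL.
have wh : size w <= h.
  move: w_le0 ws_le0 hC wC.
  by move: (expsum t (flatten ws)) (expsum t w) (size w) => a b d; lia.
have [s [k [ws_run kE sE]]] := @run_word loads w [::] h wh.
have [|s' [k' [run' k'E s'E]]] := IH k wsL' CP; first by rewrite kE -addrA.
exists (s ++ s'), k'; split; last by rewrite cl_cat sE s'E word_at_cat kE.
  by apply: run_trans run'; apply: RunLoad wL _; rewrite cats0 in ws_run.
by rewrite k'E kE -addrA.
Qed.

(** An element w belongs to M if and only if the reader has a null run that
    reads w and then words of [loads] and returns to the starting height. *)
Theorem tower_membership_decidable : membership_decidable gen M.
Proof.
pose C := \max_(w <- loads) size w.
have CP w : w \in loads -> size w <= C by move=> wL; exact: (leq_bigmax_seq (F := size)).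
have [c' c'P] := null_run_decidable (t := t) C (finitely_many_states loads_le0).
exists c' => w; have [yes no] := c'P w; set h := word_code w + C in yes no.
suff E : M (ev w) <-> null_run t tower_rules loads w h [::] h.
  by split=> [/E/yes //|nM]; apply: no => /E.
split=> [Mw|/null_run_sound[m Mm]]; last by rewrite /word_val big_nil mulg1 => /mulgI ->.
have [ws wsL wsE] := submonoid_inverse_loads Mw.
have [e0 v1] : expsum t (w ++ flatten ws) = 0%R /\ forall h, word_at h (w ++ flatten ws) = 1.
  have /pres_classP/(pres_eq_word_at R_trivial) : pres_class R (w ++ flatten ws) = pres_class R [::].
    by rewrite -!word_val_pres word_val_cat wsE /word_val big_nil.
  by move=> [-> V]; split=> // h'; rewrite V.
have wh : size w <= h by rewrite (leq_trans (size_word_code w)) // leq_addr.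
have [s [k [w_run kE sE]]] := @run_word loads w [::] h wh.
rewrite expsum_cat in e0.
have [|s' [k' [run' k'E s'E]]] := run_loads (h := k) wsL CP.
  rewrite kE -addrA e0 addr0 /h; lia.
have k'h : k' = h by move: k'E; rewrite kE -addrA e0 addr0 => -[].
rewrite cats0 in w_run; rewrite k'h in run'.
apply: run_null (run_trans w_run run') _.
by rewrite cl_cat sE s'E kE -word_at_cat.
Qed.

End Membership.
End Tower.

(** * Surface groups *)

(** The letters of P and Q are other than a and b. Conjugating the relator gives
    [a, b] = (Q P)^-1, that is a b a^-1 = (Q P)^-1 b, or equivalently
    b a b^-1 = (Q P) a. Thus a and b can both play the part of t. *)
Section OneCommutator.
Variables (B : finType) (a b : B) (P Q : word B).
Hypothesis ab : a != b.
Hypothesis QP_avoids : avoids a b (Q ++ P).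

Let r := P ++ comm_word a b ++ Q.
Local Notation ev := (word_val (@pres_gen B [:: r])).
Local Open Scope group_scope.

Lemma ev_comm : ev (comm_word a b) = (ev (Q ++ P))^-1.
Proof.
have : ev r = 1.
  rewrite word_val_pres; apply/pres_classP.
  by have := @PresRel B [:: r] [::] [::] r (mem_head _ _); rewrite /= cats0.
rewrite /r !word_val_cat => E; apply: (mulgI (ev P)); apply: (mulIg (ev Q)).
by rewrite -mulgA E invgM mulVKg mulVg.
Qed.

Lemma word_at_relator t x c h : x != t -> (t == a) || (t == b) -> (x == a) || (x == b) ->
  expsum t (comm_word a b) = 0%R ->
  word_at t x c h (comm_word a b) = (pres_class [::] (at_level h (Q ++ P)))^-1 ->
  expsum t r = 0%R /\ word_at t x c h r = 1.
Proof.
move=> xt tab xab e0 V.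
have avoid : avoids t x (Q ++ P).
  move=> l /QP_avoids/andP[la lb].
  by case/orP: tab => /eqP->; case/orP: xab => /eqP->; rewrite ?la ?lb.
have avoidP : avoids t x P by move=> l lP; apply: avoid; rewrite mem_cat lP orbT.
have avoidQ : avoids t x Q by move=> l lQ; apply: avoid; rewrite mem_cat lQ.
rewrite /r !expsum_cat !word_at_cat !(expsum_avoids avoidP) (expsum_avoids avoidQ) e0 !addr0 V.
rewrite (word_at_level _ _ avoidP) (word_at_level _ _ avoidQ) /at_level map_cat cl_cat.
by rewrite invgM mulgVK mulgV.
Qed.

Variable W : seq (word B).

Lemma membership_decidable_first : (forall w, w \in W -> (0 <= expsum a w)%R) ->
  membership_decidable (@pres_gen B [:: r]) (submonoid_gen (map ev W)).
Proof.
have ba : b != a by rewrite eq_sym.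
apply: (tower_membership_decidable ba (avoids_inv QP_avoids)).
  move=> r'; rewrite inE => /eqP-> {r'}.
  have V h : expsum a r = 0%R /\ word_at a b (inv_word (Q ++ P)) h r = 1; last first.
    by split=> [|h]; [case: (V 0%R) | case: (V h)].
  apply: word_at_relator; rewrite ?eqxx ?orbT //.
    by rewrite /comm_word !expsum_cons /shift /= eqxx (negPf ba) /expsum /=; lia.
  rewrite -cl_level_inv /= /letter_at /shift /letter_val /gen_at /= !eqxx (negPf ba).
  by rewrite !mul1g mulg1 !addr0 addrK xvalS mulgK.
have E := ev_comm; apply/pres_classP; rewrite -!word_val_pres word_val_cat ev_inv -E.
by rewrite !ev_cons /letter_val /word_val big_nil /= !mulg1 !mulgA mulgVK.
Qed.

Lemma membership_decidable_second : (forall w, w \in W -> (0 <= expsum b w)%R) ->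
  membership_decidable (@pres_gen B [:: r]) (submonoid_gen (map ev W)).
Proof.
have avoid : avoids b a (Q ++ P) by move=> l /QP_avoids; rewrite andbC.
have ba : b != a by rewrite eq_sym.
apply: (tower_membership_decidable ab avoid).
  move=> r'; rewrite inE => /eqP-> {r'}.
  have V h : expsum b r = 0%R /\ word_at b a (Q ++ P) h r = 1; last first.
    by split=> [|h]; [case: (V 0%R) | case: (V h)].
  apply: word_at_relator; rewrite ?eqxx ?orbT //.
    by rewrite /comm_word !expsum_cons /shift /= eqxx (negPf ab) /expsum /=; lia.
  rewrite /= /letter_at /shift /letter_val /gen_at /= !eqxx (negPf ab).
  by rewrite !mul1g !mulg1 !addr0 xvalS invgM mulVKg.
have E := ev_comm; apply/pres_classP; rewrite -!word_val_pres word_val_cat.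
rewrite -[ev (Q ++ P)]invgK -E.
rewrite !ev_cons /letter_val /word_val big_nil /= !mulg1 !invgM !invgK !mulgA.
by rewrite mulgVK.
Qed.

End OneCommutator.

Lemma surface_relator_split (g : nat) (i : 'I_g) : exists P Q : word (surface_gens g),
  surface_relator g = P ++ comm_word (inl i : surface_gens g) (inr i) ++ Q /\
  avoids (inl i : surface_gens g) (inr i) (Q ++ P).
Proof.
pose comms s := flatten [seq comm_word (inl j : surface_gens g) (inr j) | j <- s].
have [s1 [s2 [sE si]]] : exists s1 s2, enum 'I_g = s1 ++ i :: s2 /\ i \notin s2 ++ s1.
  have ig : i \in enum 'I_g by rewrite mem_enum.
  have := enum_uniq 'I_g; case/splitPr E: {1}(enum 'I_g) / ig => [s1 s2].
  by rewrite E uniq_catC /= => /andP[]; exists s1, s2.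
exists (comms s1), (comms s2); split; first by rewrite /surface_relator sE map_cat flatten_cat.
move=> l; have -> : comms s2 ++ comms s1 = comms (s2 ++ s1) by rewrite /comms map_cat flatten_cat.
move=> /flattenP[_ /mapP[j js ->]].
have ji : j != i by apply: contraNneq si => <-.
have ijE k : ((inl k : surface_gens g) == inl i) = (k == i) by [].
have ijE' k : ((inr k : surface_gens g) == inr i) = (k == i) by [].
by rewrite !inE => /or4P[]/eqP-> /=; rewrite ?ijE ?ijE' ?ji.
Qed.

Theorem theorem4p1 (g : nat) (hg : 1 <= g) (t : surface_gens g)
    (W : seq (word (surface_gens g)))
    (hW : forall w, w \in W -> (0 <= expsum t w)%R) :
  membership_decidable (@surface_gen g)
    (submonoid_gen (map (word_val (@surface_gen g)) W)).
Proof.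
pose i := match t with inl i => i | inr i => i end.
have [P [Q [relE avoid]]] := surface_relator_split i.
have ab : (inl i : surface_gens g) != inr i by [].
rewrite /surface_gen /surface_group relE.
have [tE|tE] : t = inl i \/ t = inr i by rewrite /i; case: (t) => j; [left|right].
  by apply: (membership_decidable_first ab avoid) => w /hW; rewrite tE.
by apply: (membership_decidable_second ab avoid) => w /hW; rewrite tE.
Qed.
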